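(* There exist functions $h^1_{\mathrm{het}}(K)$ and $h^2_{\mathrm{het}}(K)$ that are positive and bounded (on $\mathcal G^0$) and depend only on the parameters of the LQR problem (namely on $\|A\|_{\max}$, $\|B\|_{\max}$, $\|A-BK\|_{\max}$, $\|K\|$, $\|Q\|$, $\|R\|$, $\|\Sigma_0\|$, $\mu$, $\sigma_{\min}(Q)$ and $C_{\max}(K)$), such that for any $i,j\in[M]$ and any $K$ stabilizing all $M$ systems, $$\|\nabla C^{(i)}(K)-\nabla C^{(j)}(K)\|\le\epsilon_1h^1_{\mathrm{het}}(K)+\epsilon_2h^2_{\mathrm{het}}(K).$$
   Context: Setting. There are $M\ge1$ agents, $[M]=\{1,\dots,M\}$. Agent $i$ has the system $x^{(i)}_{t+1}=A^{(i)}x^{(i)}_t+B^{(i)}u^{(i)}_t$, $A^{(i)}\in\mathbb R^{n_x\times n_x}$, $B^{(i)}\in\mathbb R^{n_x\times n_u}$, $(A^{(i)},B^{(i)})$ stabilizable, $x_0^{(i)}\sim\mathcal D$ (same $\mathcal D$ for all agents). $\mathcal D$ has mean zero, $\Sigma_0:=\mathbb E[x_0x_0^\top]$ satisfies $\mu:=\sigma_{\min}(\Sigma_0)>0$, and $\|x_0\|\le H$ almost surely. $Q\in\mathbb R^{n_x\times n_x}$, $R\in\mathbb R^{n_u\times n_u}$ are positive definite. For $K\in\mathbb R^{n_u\times n_x}$, $C^{(i)}(K):=\mathbb E\left[\sum_{t=0}^\infty x_t^{(i)\top}Qx^{(i)}_t+u_t^{(i)\top}Ru_t^{(i)}\right]$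 under $u^{(i)}_t=-Kx^{(i)}_t$ ($+\infty$ if divergent), and $K_i^*$ is a minimizer of $C^{(i)}$. $K$ stabilizes system $i$ if the spectral radius $\rho(A^{(i)}-B^{(i)}K)<1$. Matrix norms $\|\cdot\|$ are spectral; $\|S\|_{\max}:=\max_i\|S^{(i)}\|$ for a family of matrices (e.g. $\|A-BK\|_{\max}=\max_i\|A^{(i)}-B^{(i)}K\|$); $C_{\max}(K):=\max_iC^{(i)}(K)$. Heterogeneity: $\epsilon_1,\epsilon_2>0$ are constants with $\max_{i,j}\|A^{(i)}-A^{(j)}\|\le\epsilon_1$ and $\max_{i,j}\|B^{(i)}-B^{(j)}\|\le\epsilon_2$. $K_0$ is a given controller stabilizing all $M$ systems and, for a fixed finite constant $\beta\ge1$, $\mathcal G^0:=\bigcap_{i=1}^M\{K:\ C^{(i)}(K)-C^{(i)}(K_i^* )\le\beta(C^{(i)}(K_0)-C^{(i)}(K_i^* ))\}$. *)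

(* Defs.v *)
From HB Require Import structures.
From mathcomp Require Import all_boot all_order all_algebra.
From mathcomp Require Import complex.
From mathcomp Require Import all_classical all_reals all_analysis.

Set Implicit Arguments.
Unset Strict Implicit.
Unset Printing Implicit Defensive.

Import Order.TTheory GRing.Theory Num.Theory.
Import numFieldNormedType.Exports.

Local Open Scope classical_set_scope.
Local Open Scope ring_scope.

(* The library norm `|A| of a matrix is the entrywise max norm, hence the norms
   defined here. *)

Definition enorm (R : realType) (n : nat) (x : 'cV[R]_n) : R :=
  Num.sqrt (\sum_(k < n) x k 0 ^+ 2).

Definition specnorm (R : realType) (m n : nat) (S : 'M[R]_(m, n)) : R :=
  sup [set enorm (S *m x) | x in [set x : 'cV[R]_n | enorm x <= 1]].

Definition singular_value (R : realType) (n : nat) (S : 'M[R]_n) : set R :=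
  [set s | 0 <= s /\ eigenvalue (S^T *m S) (s ^+ 2)].

Definition sigma_min (R : realType) (n : nat) (S : 'M[R]_n) : R :=
  inf (singular_value S).

(* A real matrix may have no real eigenvalue: S is mapped to R[i] first. *)
Definition spectral_radius (R : realType) (n : nat) (S : 'M[R]_n) : R :=
  sup [set ComplexField.Normc.normc l |
        l in [set l : R[i] | eigenvalue (map_mx (real_complex R) S) l]].

Definition posdef (R : realType) (n : nat) (S : 'M[R]_n) : Prop :=
  S^T = S /\ forall x : 'cV[R]_n, x != 0 -> 0 < (x^T *m S *m x) 0 0.

Definition norm_max (R : realType) (M m n : nat) (S : 'I_M -> 'M[R]_(m, n)) : R :=
  \big[Num.max/0]_(i < M) specnorm (S i).

Definition stabilizes (R : realType) (nx nu : nat) (A : 'M[R]_nx)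
    (B : 'M[R]_(nx, nu)) (K : 'M[R]_(nu, nx)) : Prop :=
  spectral_radius (A - B *m K) < 1.

Definition stabilizable (R : realType) (nx nu : nat) (A : 'M[R]_nx)
    (B : 'M[R]_(nx, nu)) : Prop :=
  exists K : 'M[R]_(nu, nx), stabilizes A B K.

(* R^n with its Borel sigma-algebra. *)
Definition borel_cV (R : realType) (n : nat) :=
  g_sigma_algebraType (@open 'cV[R]_n).

Definition mean (R : realType) (n : nat) (D : probability (borel_cV R n) R) :
    'cV[R]_n :=
  \col_k fine 'E_D[fun x : borel_cV R n => (x : 'cV[R]_n) k 0].

Definition second_moment (R : realType) (n : nat)
    (D : probability (borel_cV R n) R) : 'M[R]_n :=
  \matrix_(k, l) fine 'E_D[fun x : borel_cV R n =>
    ((x : 'cV[R]_n) *m (x : 'cV[R]_n)^T) k l].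

Definition input (R : realType) (nx nu : nat) (K : 'M[R]_(nu, nx))
    (x : 'cV[R]_nx) : 'cV[R]_nu := - (K *m x).

Definition state (R : realType) (nx nu : nat) (A : 'M[R]_nx)
    (B : 'M[R]_(nx, nu)) (K : 'M[R]_(nu, nx)) (x0 : 'cV[R]_nx) (t : nat) :
    'cV[R]_nx :=
  iter t (fun x => A *m x + B *m input K x) x0.

Definition stage_cost (R : realType) (nx nu : nat) (Q : 'M[R]_nx)
    (Ru : 'M[R]_nu) (x : 'cV[R]_nx) (u : 'cV[R]_nu) : R :=
  (x^T *m Q *m x) 0 0 + (u^T *m Ru *m u) 0 0.

(* For positive definite Q and Ru both the series and the integral have
   nonnegative terms, so the value is +oo when they diverge. *)
Definition cost (R : realType) (nx nu : nat) (Q : 'M[R]_nx) (Ru : 'M[R]_nu)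
    (D : probability (borel_cV R nx) R) (A : 'M[R]_nx) (B : 'M[R]_(nx, nu))
    (K : 'M[R]_(nu, nx)) : \bar R :=
  (\int[D]_x0 \sum_(0 <= t <oo)
     (stage_cost Q Ru (state A B K x0 t) (input K (state A B K x0 t)))%:E)%E.

Definition cost_max (R : realType) (M nx nu : nat) (Q : 'M[R]_nx)
    (Ru : 'M[R]_nu) (D : probability (borel_cV R nx) R)
    (A : 'I_M -> 'M[R]_nx) (B : 'I_M -> 'M[R]_(nx, nu))
    (K : 'M[R]_(nu, nx)) : \bar R :=
  \big[maxe/-oo%E]_(i < M) cost Q Ru D (A i) (B i) K.

(* Matrix of partial derivatives of the real-valued cost; at a stabilizing K the
   cost is finite on a neighbourhood of K, so the use of fine is harmless. *)
Definition grad_cost (R : realType) (nx nu : nat) (Q : 'M[R]_nx)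
    (Ru : 'M[R]_nu) (D : probability (borel_cV R nx) R) (A : 'M[R]_nx)
    (B : 'M[R]_(nx, nu)) (K : 'M[R]_(nu, nx)) : 'M[R]_(nu, nx) :=
  \matrix_(a < nu, b < nx)
    'D_(delta_mx a b) (fun L : 'M[R]_(nu, nx) => fine (cost Q Ru D A B L)) K.

Definition sublevel (R : realType) (M nx nu : nat) (Q : 'M[R]_nx)
    (Ru : 'M[R]_nu) (D : probability (borel_cV R nx) R)
    (A : 'I_M -> 'M[R]_nx) (B : 'I_M -> 'M[R]_(nx, nu))
    (Kstar : 'I_M -> 'M[R]_(nu, nx)) (K0 : 'M[R]_(nu, nx)) (beta : R) :
    set 'M[R]_(nu, nx) :=
  let C i := cost Q Ru D (A i) (B i) in
  \bigcap_(i in [set: 'I_M])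
    [set K | (C i K - C i (Kstar i) <= beta%:E * (C i K0 - C i (Kstar i)))%E].

(* The only quantities a heterogeneity coefficient may depend on. *)
Record lqr_params (R : realType) := LqrParams {
  normA : R;
  normB : R;
  normAcl : R;
  normK : R;
  normQ : R;
  normRu : R;
  normSigma0 : R;
  muSigma0 : R;
  sminQ : R;
  Cmax : R
}.

Definition params_at (R : realType) (M nx nu : nat) (Q : 'M[R]_nx)
    (Ru : 'M[R]_nu) (D : probability (borel_cV R nx) R)
    (A : 'I_M -> 'M[R]_nx) (B : 'I_M -> 'M[R]_(nx, nu))
    (K : 'M[R]_(nu, nx)) : lqr_params R :=
  {| normA := norm_max A;
     normB := norm_max B;
     normAcl := norm_max (fun i => A i - B i *m K);
     normK := specnorm K;
     normQ := specnorm Q;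
     normRu := specnorm Ru;
     normSigma0 := specnorm (second_moment D);
     muSigma0 := sigma_min (second_moment D);
     sminQ := sigma_min Q;
     Cmax := fine (cost_max Q Ru D A B K) |}.

(* Main.v *)
Require Import Defs.
From HB Require Import structures.
From mathcomp Require Import all_boot all_order all_algebra.
From mathcomp Require Import complex.
From mathcomp Require Import all_classical all_reals all_analysis.
From mathcomp Require Import measurable_realfun.
From mathcomp Require Import ring lra.
Import Order.TTheory GRing.Theory Num.Theory.
Import numFieldNormedType.Exports.
Local Open Scope classical_set_scope.
Local Open Scope ring_scope.

Set Implicit Arguments.
Unset Strict Implicit.
Unset Printing Implicit Defensive.

(** Put F_i = A_i - B_i K and W = Q + K^T Ru K, and let S be the second moment of
the initial state.  When F_i is stable the cost is tr(P_i S), where P_i solves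
the Lyapunov equation P_i = W + F_i^T P_i F_i, and the gradient is 2 E_i X_i
with E_i = Ru K - B_i^T P_i F_i and X_i the summed state covariance, which
solves the transposed equation X_i = S + F_i X_i F_i^T.  The difference of two
gradients is therefore controlled by the differences P_i - P_j and X_i - X_j.
These solve Lyapunov equations too, with the small right-hand side
F_i^T P_j F_i - F_j^T P_j F_j (and its transposed analogue), whose norm is at
most a constant times eps1 + eps2 ||K||.

The bounds on these solutions come from the cost C.  With mu = sigma_min(S) and
sg = sigma_min(Q), positivity of the trace of a product of positive
semidefinite matrices gives ||P_i|| <= C / mu and ||X_i|| <= C / sg.  Comparing
right-hand sides, P_i dominates sg times the solution with right-hand side I,
so that solving a Lyapunov equation costs a factor of at most C / (mu sg)
[lyap_identity_le, lyap_difference_le].  None of these bounds involves the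
dimensions or the number of agents, which is why two universal functions of
the parameters suffice [grad_cost_difference_le].

Four facts support this argument.
- A spectral radius below 1 forces geometric decay of the powers of F
  [spectral_radius_stable]: by Cayley-Hamilton the product of the factors
  F - z over the eigenvalues z vanishes, and the factors can be removed one at
  a time, each removal being a scalar first-order recurrence.
- The least singular value of a positive semidefinite S bounds its quadratic
  form from below [sigma_min_psd]: if l is the infimum of the Rayleigh quotient
  then S - l I cannot be invertible, so l is an eigenvalue.
- The cost is differentiated without differentiating P [grad_costE]: the exact
  increment of the cost from K to K + h V is h times a trace against X', the
  covariance at K + h V, plus a term in h^2, so that only the continuity of X'
  in h is needed, and this follows from keeping the Lyapunov function of F for
  the nearby F - h B V [lyap_perturbation].
- On the sublevel set the costs are bounded by those of K0, and the first
  stage of the cost alone dominates a multiple of ||K||^2 [policy_bounded], so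
  the two functions, which increase with ||K|| and C, are bounded there. *)

(** * Quadratic forms and the spectral norm *)

Section QuadraticForms.
Variable R : realType.

Definition bil m n (S : 'M[R]_(m, n)) (y : 'cV[R]_m) (x : 'cV[R]_n) : R :=
  (y^T *m S *m x) 0 0.

Definition psd n (S : 'M[R]_n) : Prop := S^T = S /\ forall x, 0 <= bil S x x.

Lemma bilDm m n (S T : 'M[R]_(m, n)) y x : bil (S + T) y x = bil S y x + bil T y x.
Proof. by rewrite /bil mulmxDr mulmxDl mxE. Qed.

Lemma bilNm m n (S : 'M[R]_(m, n)) y x : bil (- S) y x = - bil S y x.
Proof. by rewrite /bil mulmxN mulNmx mxE. Qed.

Lemma bilZm m n a (S : 'M[R]_(m, n)) y x : bil (a *: S) y x = a * bil S y x.
Proof. by rewrite /bil -scalemxAr -scalemxAl mxE. Qed.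

Lemma bil0m m n y x : bil (0 : 'M[R]_(m, n)) y x = 0.
Proof. by rewrite /bil mulmx0 mul0mx mxE. Qed.

Lemma bilDr m n (S : 'M[R]_(m, n)) y x z : bil S y (x + z) = bil S y x + bil S y z.
Proof. by rewrite /bil mulmxDr mxE. Qed.

Lemma bilNr m n (S : 'M[R]_(m, n)) y x : bil S y (- x) = - bil S y x.
Proof. by rewrite /bil mulmxN mxE. Qed.

Lemma bilZr m n (S : 'M[R]_(m, n)) y a x : bil S y (a *: x) = a * bil S y x.
Proof. by rewrite /bil -scalemxAr mxE. Qed.

Lemma bil_tr m n (S : 'M[R]_(m, n)) y x : bil S^T x y = bil S y x.
Proof.
rewrite /bil; have -> : x^T *m S^T *m y = (y^T *m S *m x)^T.
  by rewrite !trmx_mul trmxK mulmxA.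
by rewrite mxE.
Qed.

Lemma bilDl m n (S : 'M[R]_(m, n)) y z x : bil S (y + z) x = bil S y x + bil S z x.
Proof. by rewrite -bil_tr bilDr !bil_tr. Qed.

Lemma bilNl m n (S : 'M[R]_(m, n)) y x : bil S (- y) x = - bil S y x.
Proof. by rewrite -bil_tr bilNr bil_tr. Qed.

Lemma bilZl m n (S : 'M[R]_(m, n)) a y x : bil S (a *: y) x = a * bil S y x.
Proof. by rewrite -bil_tr bilZr bil_tr. Qed.

Definition bilE :=
  (bilDm, bilNm, bilZm, bilDl, bilNl, bilZl, bilDr, bilNr, bilZr, bil0m).

Lemma bil_mul m n p q (F : 'M[R]_(m, p)) (S : 'M[R]_(m, n)) (G : 'M[R]_(n, q)) y x :
  bil (F^T *m S *m G) y x = bil S (F *m y) (G *m x).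
Proof. by rewrite /bil trmx_mul !mulmxA. Qed.

Lemma bil_mulmx m n p (S : 'M[R]_(m, n)) (G : 'M[R]_(n, p)) y x :
  bil (S *m G) y x = bil S y (G *m x).
Proof. by rewrite /bil !mulmxA. Qed.

Lemma bil_sym n (S : 'M[R]_n) y x : S^T = S -> bil S y x = bil S x y.
Proof. by move=> eS; rewrite -bil_tr eS. Qed.

Lemma bil1E n (y x : 'cV[R]_n) : bil 1%:M y x = \sum_k y k 0 * x k 0.
Proof. by rewrite /bil mulmx1 mxE; apply: eq_bigr => k _; rewrite mxE. Qed.

Lemma bil_delta m n (S : 'M[R]_(m, n)) a b :
  bil S (delta_mx a 0) (delta_mx b 0) = S a b.
Proof. by rewrite /bil trmx_delta -rowE -colE !mxE. Qed.

(** The form is nonnegative on every combination a x + b y; the choice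
a = S(y, y), b = - S(y, x) gives the inequality multiplied by S(y, y).  If
S(y, y) = 0 the roles of x and y are exchanged, and if S(x, x) = 0 as well the
vectors x + y and x - y show that S(y, x) = 0. *)
Lemma bil_psd_CS n (S : 'M[R]_n) y x :
  psd S -> bil S y x ^+ 2 <= bil S y y * bil S x x.
Proof.
move=> [eS S0].
have hx := S0 x; have hy := S0 y.
have h (a b : R) := S0 (a *: x + b *: y).
have {}h (a b : R) : 0 <= a ^+ 2 * bil S x x + 2 * (a * b) * bil S y x + b ^+ 2 * bil S y y.
  have := h a b; rewrite !bilE (bil_sym x y eS) => /le_trans; apply.
  by rewrite le_eqVlt; apply/orP; left; apply/eqP; ring.
set b := bil S y x in h *; set a := bil S y y in hy h *; set c := bil S x x in hx h *.
have [a0|a0] := ltP 0 a.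
  have := h a (- b); rewrite -(pmulr_rge0 _ a0) => {}h.
  rewrite -subr_ge0 -(pmulr_rge0 _ a0) -(pmulr_rge0 _ a0); apply: le_trans h _.
  by rewrite le_eqVlt; apply/orP; left; apply/eqP; ring.
have {a0 hy}a0 : a = 0 by apply/eqP; rewrite eq_le a0 hy.
have [c0|c0] := ltP 0 c.
  have := h (- b) c; rewrite a0 => {}h.
  have {}h : b ^+ 2 * c <= 0 by lra.
  by rewrite mul0r -(pmulr_lle0 _ c0).
have {c0 hx}c0 : c = 0 by apply/eqP; rewrite eq_le c0 hx.
have h1 := h 1 1; have h2 := h 1 (-1).
have -> : b = 0 by lra.
by rewrite a0 mul0r expr2 mul0r.
Qed.

Lemma psd1 n : psd (1%:M : 'M[R]_n).
Proof.
split=> [|x]; first by rewrite trmx1.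
by rewrite bil1E; apply: sumr_ge0 => k _; rewrite -expr2 sqr_ge0.
Qed.

Lemma bil1_ge0 n (x : 'cV[R]_n) : 0 <= bil 1%:M x x.
Proof. by case: (psd1 n). Qed.

Lemma enorm_sqr n (x : 'cV[R]_n) : enorm x ^+ 2 = bil 1%:M x x.
Proof.
rewrite /enorm sqr_sqrtr; last by apply: sumr_ge0 => k _; apply: sqr_ge0.
by rewrite bil1E; apply: eq_bigr => k _; rewrite expr2.
Qed.

Lemma enorm_ge0 n (x : 'cV[R]_n) : 0 <= enorm x.
Proof. exact: sqrtr_ge0. Qed.
Hint Resolve enorm_ge0 : core.

Lemma enorm_eq0 n (x : 'cV[R]_n) : enorm x = 0 -> x = 0.
Proof.
move=> x0; apply/matrixP => i j; rewrite ord1 mxE.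
have := enorm_sqr x; rewrite x0 expr2 mul0r bil1E => /esym /eqP.
rewrite psumr_eq0; last by move=> k _; rewrite -expr2 sqr_ge0.
by move=> /allP /(_ i); rewrite mem_index_enum mulf_eq0 orbb => /(_ isT) /eqP.
Qed.

Lemma enorm0 n : enorm (0 : 'cV[R]_n) = 0.
Proof. by rewrite /enorm big1 ?sqrtr0 // => k _; rewrite mxE expr2 mul0r. Qed.

Lemma enormZ n a (x : 'cV[R]_n) : enorm (a *: x) = `|a| * enorm x.
Proof.
apply/eqP; rewrite -(@eqrXn2 _ 2) ?mulr_ge0 //.
by rewrite exprMn !enorm_sqr !bilE real_normK ?num_real // expr2 mulrA.
Qed.

Lemma enorm_CS n (y x : 'cV[R]_n) : `|bil 1%:M y x| <= enorm y * enorm x.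
Proof.
rewrite -(@ler_pXn2r _ 2) ?nnegrE ?mulr_ge0 // exprMn !enorm_sqr.
by rewrite real_normK ?num_real //; apply: bil_psd_CS; exact: psd1.
Qed.

Lemma enormD n (y x : 'cV[R]_n) : enorm (y + x) <= enorm y + enorm x.
Proof.
rewrite -(@ler_pXn2r _ 2) ?nnegrE ?addr_ge0 // sqrrD !enorm_sqr !bilE.
have h := le_trans (ler_norm _) (enorm_CS y x).
by rewrite (bil_sym x y (trmx1 _ _)); lra.
Qed.

Lemma entry_le_enorm n (x : 'cV[R]_n) k : `|x k 0| <= enorm x.
Proof.
rewrite -(@ler_pXn2r _ 2) ?nnegrE // enorm_sqr bil1E (bigD1 k) //=.
rewrite real_normK ?num_real // expr2 lerDl.
by apply: sumr_ge0 => j _; rewrite -expr2 sqr_ge0.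
Qed.

Lemma enorm_le_sum n (x : 'cV[R]_n) : enorm x <= \sum_k `|x k 0|.
Proof.
rewrite -(@ler_pXn2r _ 2) ?nnegrE ?sumr_ge0 // enorm_sqr bil1E.
rewrite expr2 mulr_suml; apply: ler_sum => k _.
rewrite -[leLHS]ger0_norm -?expr2 ?sqr_ge0 // expr2 normrM.
apply: ler_wpM2l => //; rewrite (bigD1 k) //= lerDl.
by apply: sumr_ge0.
Qed.

Lemma enorm_delta n (k : 'I_n) : enorm (delta_mx k 0 : 'cV[R]_n) = 1.
Proof.
apply/eqP; rewrite -(@eqrXn2 _ 2) // enorm_sqr bil_delta mxE eqxx expr1n //.
Qed.

Lemma enorm_mulmx_entries m n (S : 'M[R]_(m, n)) x :
  enorm (S *m x) <= (\sum_i \sum_j `|S i j|) * enorm x.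
Proof.
apply: le_trans (enorm_le_sum _) _.
rewrite mulr_suml; apply: ler_sum => i _; rewrite mxE.
apply: le_trans (ler_norm_sum _ _ _) _.
rewrite mulr_suml; apply: ler_sum => j _; rewrite normrM.
by apply: ler_wpM2l => //; exact: entry_le_enorm.
Qed.

Lemma specnorm_has_sup m n (S : 'M[R]_(m, n)) :
  has_sup [set enorm (S *m x) | x in [set x : 'cV[R]_n | enorm x <= 1]].
Proof.
split; first by exists (enorm (S *m 0)), 0 => //=; rewrite enorm0.
exists (\sum_i \sum_j `|S i j|) => _ [x /= x1 <-].
apply: le_trans (enorm_mulmx_entries S x) _.
rewrite -[leRHS]mulr1; apply: ler_wpM2l => //.
by apply: sumr_ge0 => i _; apply: sumr_ge0.
Qed.

Lemma specnorm_ge0 m n (S : 'M[R]_(m, n)) : 0 <= specnorm S.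
Proof.
apply: (sup_upper_bound (specnorm_has_sup S)).
by exists 0; rewrite /= ?mulmx0 enorm0.
Qed.
Hint Resolve specnorm_ge0 : core.

Lemma enorm_mulmx m n (S : 'M[R]_(m, n)) x : enorm (S *m x) <= specnorm S * enorm x.
Proof.
have [/enorm_eq0->|x0] := eqVneq (enorm x) 0.
  by rewrite mulmx0 !enorm0 mulr0.
have xp : 0 < enorm x by rewrite lt_def x0 enorm_ge0.
rewrite -ler_pdivrMr // mulrC -[(enorm x)^-1]ger0_norm ?invr_ge0 //.
rewrite -enormZ scalemxAr.
apply: (sup_upper_bound (specnorm_has_sup S)); exists ((enorm x)^-1 *: x) => //=.
by rewrite enormZ ger0_norm ?invr_ge0 // mulVf.
Qed.

Lemma specnorm_le m n (S : 'M[R]_(m, n)) c :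
  0 <= c -> (forall x, enorm (S *m x) <= c * enorm x) -> specnorm S <= c.
Proof.
move=> c0 h; apply: ge_sup; first by case: (specnorm_has_sup S).
move=> _ [x /= x1 <-]; apply: le_trans (h x) _.
by rewrite -[leRHS]mulr1; apply: ler_wpM2l.
Qed.

Lemma specnorm_le_entries m n (S : 'M[R]_(m, n)) : specnorm S <= \sum_i \sum_j `|S i j|.
Proof.
apply: specnorm_le => [|x]; last exact: enorm_mulmx_entries.
by apply: sumr_ge0 => i _; apply: sumr_ge0.
Qed.

Lemma specnormM m n p (S : 'M[R]_(m, n)) (T : 'M[R]_(n, p)) :
  specnorm (S *m T) <= specnorm S * specnorm T.
Proof.
apply: specnorm_le => [|x]; first exact: mulr_ge0.
rewrite -mulmxA -mulrA; apply: le_trans (enorm_mulmx _ _) _.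
by apply: ler_wpM2l => //; exact: enorm_mulmx.
Qed.

Lemma specnormD m n (S T : 'M[R]_(m, n)) : specnorm (S + T) <= specnorm S + specnorm T.
Proof.
apply: specnorm_le => [|x]; first exact: addr_ge0.
rewrite mulmxDl mulrDl; apply: le_trans (enormD _ _) _.
by apply: lerD; exact: enorm_mulmx.
Qed.

Lemma specnormZ_le m n a (S : 'M[R]_(m, n)) : specnorm (a *: S) <= `|a| * specnorm S.
Proof.
apply: specnorm_le => [|x]; first exact: mulr_ge0.
by rewrite -scalemxAl enormZ -mulrA; apply: ler_wpM2l => //; exact: enorm_mulmx.
Qed.

Lemma specnormN m n (S : 'M[R]_(m, n)) : specnorm (- S) <= specnorm S.
Proof. by have := specnormZ_le (-1) S; rewrite scaleN1r normrN1 mul1r. Qed.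

Lemma normr_bil m n (S : 'M[R]_(m, n)) y x :
  `|bil S y x| <= specnorm S * (enorm y * enorm x).
Proof.
rewrite -[S]mul1mx bil_mulmx; apply: le_trans (enorm_CS _ _) _.
rewrite mul1mx mulrCA; apply: ler_wpM2l => //; exact: enorm_mulmx.
Qed.

Lemma specnorm_le_bil m n (S : 'M[R]_(m, n)) c : 0 <= c ->
  (forall y x, bil S y x <= c * (enorm y * enorm x)) -> specnorm S <= c.
Proof.
move=> c0 h; apply: specnorm_le => // x.
have [->|Sx0] := eqVneq (enorm (S *m x)) 0; first exact: mulr_ge0.
have Sxp : 0 < enorm (S *m x) by rewrite lt_def Sx0 enorm_ge0.
rewrite -(ler_pM2l Sxp) -expr2 enorm_sqr -bil_mulmx mul1mx.
by rewrite mulrCA; exact: h.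
Qed.

Lemma specnorm_tr m n (S : 'M[R]_(m, n)) : specnorm S^T <= specnorm S.
Proof.
apply: specnorm_le_bil => // y x; rewrite bil_tr [enorm y * _]mulrC.
exact: le_trans (ler_norm _) (normr_bil _ _ _).
Qed.

Lemma entry_le_specnorm m n (S : 'M[R]_(m, n)) a b : `|S a b| <= specnorm S.
Proof.
by rewrite -bil_delta; apply: le_trans (normr_bil _ _ _) _; rewrite !enorm_delta !mulr1.
Qed.

Lemma bil_le_specnorm n (S : 'M[R]_n) x : `|bil S x x| <= specnorm S * bil 1%:M x x.
Proof. by rewrite -enorm_sqr expr2; exact: normr_bil. Qed.

(** Polarization: 4 Z(x, y) is the difference of the form at x + y and x - y,
and y is taken to be Z x rescaled to the length of x. *)
Lemma specnorm_sym_le n (Z : 'M[R]_n) c : 0 <= c -> Z^T = Z ->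
  (forall x, `|bil Z x x| <= c * bil 1%:M x x) -> specnorm Z <= c.
Proof.
move=> c0 eZ h.
apply: specnorm_le => // x.
have [->|Zx0] := eqVneq (enorm (Z *m x)) 0; first exact: mulr_ge0.
have Zxp : 0 < enorm (Z *m x) by rewrite lt_def Zx0 enorm_ge0.
set a := enorm x; set b := enorm (Z *m x).
have [x0|x0] := eqVneq a 0.
  by move: Zx0; rewrite (enorm_eq0 x0) mulmx0 enorm0 eqxx.
have xp : 0 < a by rewrite lt_def x0 enorm_ge0.
have [y yy yx] : exists2 y, bil 1%:M y y = a ^+ 2 & bil Z y x = a * b.
  exists ((a / b) *: (Z *m x)).
    by rewrite !bilE -enorm_sqr -/b; field; rewrite Zx0.
  by rewrite !bilE -[Z in bil Z]mul1mx bil_mulmx -enorm_sqr -/b; field; rewrite Zx0.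
have h1 := le_trans (ler_norm _) (h (x + y)).
have h2 := h (x - y); rewrite -normrN in h2.
have {}h2 := le_trans (ler_norm _) h2.
move: h1 h2; rewrite !bilE !yy -[bil 1%:M x x]enorm_sqr -/a.
rewrite [bil Z x y](bil_sym _ _ eZ) [bil 1%:M x y](bil_sym _ _ (trmx1 _ _)) !yx => h1 h2.
have : a * b <= a * (c * a) by lra.
by rewrite ler_pM2l.
Qed.

End QuadraticForms.

#[local] Hint Extern 0 (is_true (0 <= enorm _)) => exact: enorm_ge0 : core.
#[local] Hint Extern 0 (is_true (0 <= specnorm _)) => exact: specnorm_ge0 : core.
#[local] Hint Extern 0 (is_true (0 <= bil 1%:M _ _)) => exact: bil1_ge0 : core.

(** * Positive semidefinite matrices *)

Section PositiveSemidefinite.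
Variable R : realType.
Implicit Types (n : nat).

Lemma psdD n (S T : 'M[R]_n) : psd S -> psd T -> psd (S + T).
Proof.
move=> [eS S0] [eT T0]; split=> [|x]; first by rewrite linearD /= eS eT.
by rewrite bilDm addr_ge0.
Qed.

Lemma psdZ n a (S : 'M[R]_n) : 0 <= a -> psd S -> psd (a *: S).
Proof.
move=> a0 [eS S0]; split=> [|x]; first by rewrite linearZ /= eS.
by rewrite bilZm mulr_ge0.
Qed.

Lemma psd_congr m n (F : 'M[R]_(m, n)) (S : 'M[R]_m) : psd S -> psd (F^T *m S *m F).
Proof.
move=> [eS S0]; split=> [|x]; last by rewrite bil_mul.
by rewrite !trmx_mul trmxK eS mulmxA.
Qed.

Lemma psd_rank1 n (v : 'cV[R]_n) : psd (v *m v^T).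
Proof.
have := psd_congr v^T (psd1 R 1).
by rewrite trmxK mulmx1.
Qed.

Lemma psd_row_eq0 n (S : 'M[R]_n) i : psd S -> S i i = 0 -> forall j, S i j = 0.
Proof.
move=> pS Si0 j; have := bil_psd_CS (delta_mx i 0) (delta_mx j 0) pS.
rewrite !bil_delta Si0 mul0r => h.
by apply/eqP; rewrite -sqrf_eq0 eq_le h sqr_ge0.
Qed.

(** Cholesky without ordering the pivots: if S i i != 0, subtracting the rank one
matrix built from column i keeps S positive semidefinite by Cauchy-Schwarz and
kills the entry (i, i), while diagonal entries that vanish do so together with
their rows and stay zero.  The number of nonzero diagonal entries decreases. *)
Lemma psd_sum_rank1 n (S : 'M[R]_n) : psd S ->
  exists s : seq 'cV[R]_n, S = \sum_(v <- s) v *m v^T.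
Proof.
have [k] := ubnP #|[pred i | S i i != 0]|.
elim: k S => // k IH S lt_k pS.
have [i Si0|S0] := pickP [pred i | S i i != 0]; last first.
  exists [::]; rewrite big_nil; apply/matrixP => i j; rewrite mxE.
  by apply: psd_row_eq0 pS _ _; have /negbFE/eqP := S0 i.
rewrite /= in Si0; have Sii : 0 < S i i by rewrite lt_def Si0 -bil_delta /=; case: pS => _; apply.
have [q q0 sq] : exists2 q, q != 0 & q ^+ 2 = S i i.
  exists (Num.sqrt (S i i)); last by rewrite sqr_sqrtr // ltW.
  by rewrite sqrtr_eq0 -ltNge.
(* the normalized pivot column; v v^T agrees with S on row and column i *)
pose v : 'cV[R]_n := q^-1 *: (S *m delta_mx i 0).
have vE j : v j 0 = q^-1 * S j i.
  by rewrite mxE -colE mxE.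
have vvE j l : (v *m v^T) j l = S j i * S l i / S i i.
  rewrite mxE big_ord1 [v^T _ _]mxE !vE -sq; field; exact: q0.
have pS' : psd (S - v *m v^T).
  split=> [|x]; first by rewrite linearB /= trmx_mul trmxK; case: pS => ->.
  have := bil_psd_CS (delta_mx i 0) x pS; rewrite bil_delta => h.
  have vx : bil (v *m v^T) x x = bil S (delta_mx i 0) x ^+ 2 / S i i.
    rewrite -[v *m v^T](_ : v^T^T *m 1%:M *m v^T = _); last by rewrite trmxK mulmx1.
    rewrite bil_mul bil1E big_ord1.
    have -> : (v^T *m x) 0 0 = q^-1 * bil S (delta_mx i 0) x.
      have -> : (v^T *m x) 0 0 = bil 1%:M v x by rewrite /bil mulmx1.
      by rewrite /v bilZl bil_sym ?trmx1 // -bil_mulmx mul1mx bil_sym //; case: pS.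
    by rewrite -[in RHS]sq; field; rewrite q0.
  rewrite !bilE vx subr_ge0 ler_pdivrMr //; by rewrite mulrC.
suff lt_k' : (#|[pred j : 'I_n | ((S - v *m v^T) j j != 0)%R]| < k)%N.
  have [s sE] := IH _ lt_k' pS'.
  by exists (v :: s); rewrite big_cons -sE addrC subrK.
rewrite -ltnS; apply: leq_trans lt_k; rewrite ltnS.
apply: proper_card; apply/properP; split.
  apply/fintype.subsetP => j; rewrite !inE !mxE; apply: contra => /eqP Sj0.
  have := vvE j j; rewrite mxE => ->.
  by rewrite Sj0 (psd_row_eq0 pS Sj0) !mul0r subr0.
exists i; rewrite !inE //.
have := vvE i i; rewrite !mxE => ->.
by rewrite mulfK // subrr eqxx.
Qed.

(** On a rank one summand v v^T of P the trace is the value of the form S at v. *)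
Lemma mxtrace_psd_ge0 n (P S : 'M[R]_n) : psd P -> psd S -> 0 <= \tr (P *m S).
Proof.
move=> /psd_sum_rank1 [s ->] [_ S0].
rewrite mulmx_suml raddf_sum /=; apply: sumr_ge0 => v _.
by rewrite -mulmxA mxtrace_mulC trace_mx11; exact: S0.
Qed.

Lemma mxtrace_psd_lower n mu (P S : 'M[R]_n) :
  psd P -> psd (S - mu *: 1%:M) -> mu * \tr P <= \tr (P *m S).
Proof.
move=> pP pS; have := mxtrace_psd_ge0 pP pS.
by rewrite mulmxBr -scalemxAr mulmx1 linearB linearZ /= subr_ge0.
Qed.

(** The trace of P against |x|^2 I - x x^T, which is positive semidefinite by
Cauchy-Schwarz, is nonnegative. *)
Lemma psd_bil_le_trace n (P : 'M[R]_n) x : psd P -> bil P x x <= \tr P * bil 1%:M x x.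
Proof.
move=> pP.
have pS : psd (bil 1%:M x x *: 1%:M - x *m x^T).
  split=> [|y]; first by rewrite linearB linearZ /= trmx1 trmx_mul trmxK.
  rewrite !bilE subr_ge0 mulrC.
  apply: le_trans (bil_psd_CS y x (psd1 R n)).
  rewrite -[x *m x^T](_ : x^T^T *m 1%:M *m x^T = _); last by rewrite trmxK mulmx1.
  rewrite bil_mul bil1E big_ord1.
  have -> : (x^T *m y) 0 0 = bil 1%:M y x by rewrite bil_sym ?trmx1 // /bil mulmx1.
  by rewrite expr2.
have := mxtrace_psd_ge0 pP pS.
rewrite mulmxBr -scalemxAr mulmx1 linearB linearZ /= subr_ge0 mulrC mulmxA.
by rewrite mxtrace_mulC mulmxA trace_mx11.
Qed.

Lemma psd_specnorm_le n (P : 'M[R]_n) c : 0 <= c -> psd P ->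
  (forall x, bil P x x <= c * bil 1%:M x x) -> specnorm P <= c.
Proof.
move=> c0 [eP P0] h; apply: specnorm_sym_le => // x.
by rewrite ger0_norm.
Qed.

Lemma psd_specnorm_le_trace n mu (P S : 'M[R]_n) : 0 < mu ->
  psd P -> psd (S - mu *: 1%:M) -> specnorm P <= \tr (P *m S) / mu.
Proof.
move=> mu0 pP pS; have h := mxtrace_psd_lower pP pS.
have tP : 0 <= \tr P by have := mxtrace_psd_ge0 pP (psd1 R n); rewrite mulmx1.
have : \tr P <= \tr (P *m S) / mu by rewrite ler_pdivlMr // mulrC.
apply: le_trans; apply: psd_specnorm_le => // x; exact: psd_bil_le_trace.
Qed.

(** Cauchy-Schwarz for S at x and y = S^-1 x reads
|x|^4 <= (x^T S^-1 x) (x^T S x), and the first factor is at most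
||S^-1|| |x|^2.  The rate 1 / (||S^-1|| + 1) avoids dividing by zero. *)
Lemma psd_unit_coercive n (S : 'M[R]_n) : psd S -> S \in unitmx ->
  exists2 c, 0 < c & psd (S - c *: 1%:M).
Proof.
move=> pS uS; set s := specnorm (invmx S).
have s0 : 0 <= s := specnorm_ge0 _.
have s1 : 0 < s + 1 by rewrite ltr_wpDl.
exists (s + 1)^-1; first by rewrite invr_gt0.
split=> [|x]; first by rewrite linearB linearZ /= trmx1; case: pS => ->.
rewrite !bilE subr_ge0 mulrC ler_pdivrMr //.
set q := bil S x x; set a := bil 1%:M x x.
have q0 : 0 <= q by case: pS => _; apply.
pose y := invmx S *m x.
have h := bil_psd_CS y x pS.
have Sy : S *m y = x by rewrite mulKVmx.
have e1 : bil S y x = a by case: (pS) => eS _; rewrite bil_sym // -[S]mul1mx bil_mulmx Sy.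
have e2 : bil S y y <= s * a.
  rewrite -[S]mul1mx bil_mulmx Sy bil_sym ?trmx1 // -bil_mulmx mul1mx.
  exact: le_trans (ler_norm _) (bil_le_specnorm _ _).
rewrite e1 in h.
have {}h : a * a <= a * (s * q).
  rewrite -expr2; apply: le_trans h _.
  by rewrite [leRHS]mulrCA mulrA; apply: ler_wpM2r.
have [a0|a0] := ltP 0 a.
  by rewrite ler_pM2l // in h; nra.
apply: le_trans a0 _; apply: mulr_ge0 => //; exact: ltW.
Qed.

Lemma notin_unitmx_ker n (S : 'M[R]_n) :
  S \notin unitmx -> exists2 x : 'cV[R]_n, x != 0 & S *m x = 0.
Proof.
rewrite -unitmx_tr unitmxE unitfE negbK => /det0P [v v0 vS].
exists v^T; first by rewrite trmx_eq0.
by apply: trmx_inj; rewrite trmx_mul trmxK vS trmx0.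
Qed.

Lemma posdef_psd n (S : 'M[R]_n) : posdef S -> psd S.
Proof.
move=> [eS S0]; split=> // x.
have [->|x0] := eqVneq x 0; last exact: ltW (S0 x x0).
by rewrite /bil mulmx0 mxE.
Qed.

Lemma posdef_coercive n (S : 'M[R]_n) : posdef S -> exists2 c, 0 < c & psd (S - c *: 1%:M).
Proof.
move=> pS; apply: psd_unit_coercive; first exact: posdef_psd.
apply/negPn/negP => /notin_unitmx_ker [x x0 Sx].
by have := pS.2 x x0; rewrite -mulmxA Sx mulmx0 mxE ltxx.
Qed.

Lemma psd_subr_le n (S : 'M[R]_n) a b : b <= a -> psd (S - a *: 1%:M) -> psd (S - b *: 1%:M).
Proof.
move=> ba pS; have -> : S - b *: 1%:M = (S - a *: 1%:M) + (a - b) *: 1%:M.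
  by rewrite scalerBl addrA subrK.
by apply: psdD => //; apply: psdZ; rewrite ?subr_ge0 //; exact: psd1.
Qed.

(** The infimum l of the Rayleigh quotient is an eigenvalue: S - l I is positive
semidefinite, and were it invertible it would be coercive, so that l could be
increased. *)
Lemma psd_singular_value n (S : 'M[R]_n) : (0 < n)%N -> psd S ->
  exists2 l, singular_value S l & psd (S - l *: 1%:M).
Proof.
move=> n0 pS; have [eS S0] := pS.
pose E := [set bil S x x | x in [set x : 'cV[R]_n | bil 1%:M x x = 1]].
have E0 : E !=set0.
  exists (S (Ordinal n0) (Ordinal n0)), (delta_mx (Ordinal n0) 0); last exact: bil_delta.
  by rewrite /= bil_delta mxE eqxx.
have lE : has_inf E by split=> //; exists 0 => _ [x _ <-].
set l := inf E.
have l0 : 0 <= l by apply: lb_le_inf => // _ [x _ <-].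
have pSE c : (forall y, E y -> c <= y) <-> psd (S - c *: 1%:M).
  split=> [h|[_ h] _ [x x1 <-]]; last first.
    by have := h x; rewrite !bilE subr_ge0 x1 mulr1.
  split=> [|x]; first by rewrite linearB linearZ /= trmx1 eS.
  rewrite !bilE subr_ge0 -enorm_sqr.
  have [/enorm_eq0->|x0] := eqVneq (enorm x) 0.
    by rewrite enorm0 expr2 !mulr0; exact: S0.
  have : c <= bil S ((enorm x)^-1 *: x) ((enorm x)^-1 *: x).
    apply: h; exists ((enorm x)^-1 *: x) => //=.
    by rewrite !bilE -enorm_sqr; field.
  rewrite !bilE mulrA -invfM mulrC ler_pdivlMr //.
  by rewrite -expr2 lt_def sqrf_eq0 x0 sqr_ge0.
have pSl : psd (S - l *: 1%:M) by apply/pSE => y Ey; exact: (ge_inf lE.2).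
exists l => //; split=> //.
have [uS|/notin_unitmx_ker [x x0 Sx]] := boolP (S - l *: 1%:M \in unitmx).
  have [c c0] := psd_unit_coercive pSl uS.
  rewrite -addrA -opprD -scalerDl => /pSE /(lb_le_inf E0).
  by rewrite -/l gerDl leNgt c0.
move: Sx; rewrite mulmxBl -scalemxAl mul1mx => /subr0_eq Sx.
apply/eigenvalueP; exists x^T; last by rewrite trmx_eq0.
apply: trmx_inj; rewrite linearZ /= !trmx_mul !trmxK -mulmxA eS Sx.
by rewrite -scalemxAr Sx scalerA expr2.
Qed.

Lemma has_lbound_singular_value n (S : 'M[R]_n) : has_lbound (singular_value S).
Proof. by exists 0 => s []. Qed.

(** The singular value found at the bottom of the Rayleigh quotient is at least
sigma_min S. *)
Lemma sigma_min_psd n (S : 'M[R]_n) : (0 < n)%N -> psd S ->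
  psd (S - sigma_min S *: 1%:M).
Proof.
move=> n0 pS; have [l Sl] := psd_singular_value n0 pS.
apply: psd_subr_le; exact: (ge_inf (has_lbound_singular_value S)).
Qed.

(** If S v has length s |v|, then c |v|^2 <= v^T S v <= s |v|^2 for every
coercivity constant c of S, so c bounds all singular values from below. *)
Lemma sigma_min_gt0 n (S : 'M[R]_n) : (0 < n)%N -> posdef S -> 0 < sigma_min S.
Proof.
move=> n0 pS; have [c c0 [eS hS]] := posdef_coercive pS.
apply: lt_le_trans c0 _; apply: lb_le_inf.
  by have [l Sl _] := psd_singular_value n0 (posdef_psd pS); exists l.
move=> s [s0 /eigenvalueP [v vS v0]].
have /(congr1 (fun u => (u *m v^T) 0 0)) := vS.
have v0' : 0 < bil 1%:M v^T v^T.
  rewrite lt_def (bil1_ge0 _) andbT -enorm_sqr sqrf_eq0.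
  by apply: contra v0 => /eqP/enorm_eq0/eqP; rewrite trmx_eq0.
have -> : (v *m (S^T *m S) *m v^T) 0 0 = enorm (S *m v^T) ^+ 2.
  by rewrite enorm_sqr /bil trmx_mul trmxK mulmx1 !mulmxA.
have -> : (s ^+ 2 *: v *m v^T) 0 0 = (s * enorm v^T) ^+ 2.
  by rewrite -scalemxAl mxE exprMn enorm_sqr /bil trmxK mulmx1.
have sv0 : 0 <= s * enorm v^T by apply: mulr_ge0.
move=> /(pexpIrn (ltn0Sn 1)) Sv; have {}Sv := Sv (enorm_ge0 _) sv0.
have := hS v^T; rewrite !bilE subr_ge0 => h.
have {h} : c * bil 1%:M v^T v^T <= s * bil 1%:M v^T v^T.
  apply: le_trans h _; rewrite -[S]mul1mx bil_mulmx.
  apply: le_trans (le_trans (ler_norm _) (enorm_CS _ _)) _.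
  by rewrite Sv mulrCA -expr2 enorm_sqr.
by rewrite ler_pM2r.
Qed.

End PositiveSemidefinite.

(** * Stability of linear systems *)

Section Stability.

Definition geometric_decay (C : numDomainType) (u : nat -> C) (r : C) :=
  exists2 c, 0 <= c & forall t, `|u t| <= c * r ^+ t.

(** The constant c' = |u_0| + c / (r - |z|) satisfies |z| c' + c <= r c', so the
bound c' r^t propagates along u_(t+1) = z u_t + v_t when |v_t| <= c r^t. *)
Lemma geometric_decay_recurrence (C : numFieldType) (u : nat -> C) (z r : C) :
  `|z| < r -> geometric_decay (fun t => u t.+1 - z * u t) r -> geometric_decay u r.
Proof.
move=> zr [c c0 h].
have zr0 : 0 < r - `|z| by rewrite subr_gt0.
have r0 : 0 < r by apply: le_lt_trans zr.
have d0 : 0 <= c / (r - `|z|) by rewrite divr_ge0 // ltW.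
exists (`|u 0%N| + c / (r - `|z|)); first by rewrite addr_ge0.
set c' := _ + _.
have cc' : c <= (r - `|z|) * c'.
  rewrite mulrDr [leRHS]addrC mulrC divfK ?gt_eqF // lerDl.
  by rewrite mulr_ge0 // ltW.
elim=> [|t IH]; first by rewrite expr0 mulr1 lerDl.
rewrite -[u t.+1](subrK (z * u t)).
apply: le_trans (ler_normD _ _) _; rewrite normrM.
have {}h := h t.
apply: le_trans (lerD h (ler_wpM2l (normr_ge0 z) IH)) _.
have rt : 0 <= r ^+ t by rewrite exprn_ge0 // ltW.
rewrite exprS !mulrA -mulrDl ler_wpM2r //.
rewrite addrC -lerBrDl; apply: le_trans cc' _.
by rewrite mulrBl [c' * r]mulrC.
Qed.

Definition entries_decay (C : numDomainType) n (U : nat -> 'M[C]_n) (r : C) :=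
  forall i j, geometric_decay (fun t => U t i j) r.

(** If U_t is A^t times the product of the factors after A - z, then A^t times the
whole product is U_(t+1) - z U_t, so the scalar recurrence removes A - z. *)
Lemma entries_decay_factors (C : numFieldType) n (A : 'M[C]_n.+1) (s : seq C) (r : C) :
  (forall z, z \in s -> `|z| < r) ->
  entries_decay (fun t => A ^+ t * \prod_(z <- s) (A - z%:M)) r ->
  entries_decay (fun t => A ^+ t) r.
Proof.
elim: s => [|z s IH] sr.
  by move=> h i j; have [c c0 {}h] := h i j; exists c => // t; have := h t; rewrite big_nil mulr1.
rewrite big_cons => h; apply: IH => [y ys|i j]; first by apply: sr; rewrite inE ys orbT.
apply: (@geometric_decay_recurrence _ _ z); first by apply: sr; rewrite inE eqxx.
have [c c0 {}h] := h i j; exists c => // t; have := h t.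
rewrite mulrA mulrBr mulrBl -exprSr.
have -> : A ^+ t * z%:M = z *: A ^+ t := mul_mx_scalar _ _.
by rewrite -scalerAl; set X := (X in X - _); set Y := (X in _ *: X); rewrite !mxE.
Qed.

Variable R : realType.
Local Notation normc := (@ComplexField.Normc.normc R).

(** The geometric rate makes quadratic forms vanish along trajectories, and the
transpose inherits it; the spectral radius offers neither directly. *)
Definition stable n (F : 'M[R]_n) : Prop :=
  exists c r, [/\ 0 <= c, 0 <= r, r < 1 & forall t, specnorm (F ^+ t) <= c * r ^+ t].

Lemma entries_decay_stable n (F : 'M[R]_n) r :
  0 <= r -> r < 1 -> entries_decay (fun t => F ^+ t) r -> stable F.
Proof.
move=> r0 r1 h; pose c i j := s2val (cid2 (h i j)).
exists (\sum_i \sum_j c i j), r; split=> //.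
  apply: sumr_ge0 => i _; apply: sumr_ge0 => j _; exact: (s2valP (cid2 (h i j))).
move=> t; apply: le_trans (specnorm_le_entries _) _.
rewrite mulr_suml; apply: ler_sum => i _; rewrite mulr_suml; apply: ler_sum => j _.
exact: (s2valP' (cid2 (h i j))).
Qed.

Lemma normcR (z : R[i]) : `|z| = (normc z)%:C%C.
Proof. by rewrite normc_def; case: z. Qed.

Lemma map_mxX n (F : 'M[R]_n) t :
  map_mx (real_complex R) (F ^+ t) = (map_mx (real_complex R) F) ^+ t.
Proof.
elim: t => [|t IH]; first by rewrite !expr0 map_mx1.
by rewrite !exprS map_mxM IH.
Qed.

(** Over the complex numbers the product of F - z over the roots z of the
characteristic polynomial is 0 by Cayley-Hamilton, and it decays trivially. *)
Lemma spectral_radius_stable n (F : 'M[R]_n) : (0 < n)%N -> spectral_radius F < 1 -> stable F.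
Proof.
case: n F => // n F _ F1; set A := map_mx (real_complex R) F.
have [s] := closed_field_poly_normal (char_poly A).
rewrite (eqP (char_poly_monic A)) scale1r => pA.
have eigE z : eigenvalue A z = (z \in s).
  by rewrite eigenvalue_root_char pA root_prod_XsubC.
pose E := [set normc l | l in [set l : R[i] | eigenvalue A l]].
have ubE : has_ubound E.
  exists (\sum_(z <- s) normc z) => _ [z /= zA <-].
  have zs : z \in s by rewrite -eigE.
  have n0 y : 0 <= normc y by case: y => a b; exact: sqrtr_ge0.
  by rewrite (big_rem z zs) /= lerDl; apply: sumr_ge0 => y _; exact: n0.
have srho z : z \in s -> normc z <= spectral_radius F.
  by move=> zs; apply: (ub_le_sup ubE); exists z => //=; rewrite eigE.
(* a rate strictly between the spectral radius and 1 *)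
pose r := (1 + Num.max 0 (spectral_radius F)) / 2.
have r0 : 0 < r by rewrite /r divr_gt0 // ltr_pwDl // le_max lexx.
have r1 : Num.max 0 (spectral_radius F) < r < 1.
  have : Num.max 0 (spectral_radius F) < 1 by rewrite gt_max ltr01.
  rewrite /r => h; apply/andP; split; lra.
have {r1} [rr r1] := andP r1.
apply: (@entries_decay_stable _ _ r) => //; first exact: ltW.
have : entries_decay (fun t => A ^+ t) r%:C%C.
  apply: (@entries_decay_factors _ _ _ s) => [z zs|i j].
    rewrite normcR ltcR; apply: le_lt_trans rr; apply: le_trans (srho z zs) _.
    by rewrite le_max lexx orbT.
  exists 0 => // t; rewrite mul0r.
  have -> : \prod_(z <- s) (A - z%:M) = horner_mx A (char_poly A).
    rewrite pA rmorph_prod; apply: eq_bigr => z _.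
    by rewrite rmorphB /= horner_mx_X horner_mx_C.
  by rewrite Cayley_Hamilton mulr0 mxE normr0.
move=> h i j; have [c c0 {}h] := h i j.
have cR : c = (complex.Re c)%:C%C.
  by move: c0; case: (c) => a b; rewrite lecE /= => /andP [/eqP -> _].
exists (complex.Re c); first by rewrite -lecR -cR.
move=> t; have := h t; rewrite -map_mxX mxE cR.
rewrite -rmorphXn -rmorphM /= normcR lecR /= /ComplexField.Normc.normc /=.
by rewrite expr0n addr0 sqrtr_sqr.
Qed.

Lemma trmxX n (F : 'M[R]_n) t : (F ^+ t)^T = F^T ^+ t.
Proof.
elim: t => [|t IH]; first by rewrite !expr0 trmx1.
by rewrite exprS exprSr -IH trmx_mul.
Qed.

Lemma stable_tr n (F : 'M[R]_n) : stable F -> stable F^T.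
Proof.
move=> [c [r [c0 r0 r1 h]]]; exists c, r; split=> // t.
by rewrite -trmxX; apply: le_trans (specnorm_tr _) (h t).
Qed.

End Stability.

(** * The discrete Lyapunov equation *)

Section Lyapunov.
Variable R : realType.
Implicit Types (n : nat).

(** For stable F the solution is the sum over t of (F^t)^T W F^t.  Replacing F by
its transpose gives the sum of F^t W (F^t)^T, the summed state covariance when
W is the second moment of the initial state. *)
Definition lyap n (F W P : 'M[R]_n) : Prop := P = W + F^T *m P *m F.

Lemma stable_bil_cvg0 n (F P : 'M[R]_n) y x : stable F ->
  (fun t => bil P (F ^+ t *m y) (F ^+ t *m x)) @ \oo --> (0 : R).
Proof.
move=> [c [r [c0 r0 r1 h]]].
pose a := specnorm P * (c * enorm y * (c * enorm x)).
have h' z t : enorm (F ^+ t *m z) <= c * enorm z * r ^+ t.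
  apply: le_trans (enorm_mulmx _ _) _.
  by rewrite mulrAC ler_wpM2r.
apply/norm_cvg0P; apply: (@squeeze_cvgr _ _ _ _ (fun=> 0) (geometric a (r * r))).
- near=> t; rewrite normr_ge0 /=.
  apply: le_trans (normr_bil _ _ _) _; rewrite /geometric /= /a -[leRHS]mulrA ler_wpM2l //.
  apply: le_trans (ler_pM _ _ (h' y t) (h' x t)) _ => //.
  by rewrite exprMn mulrACA.
- exact: cvg_cst.
- apply: cvg_geometric; rewrite ger0_norm ?mulr_ge0 //.
  by apply: (le_lt_trans _ r1); rewrite ler_piMl // ltW.
Unshelve. all: by end_near. Qed.

Lemma mulmx_exprS n (F : 'M[R]_n) (x : 'cV[R]_n) t : F *m (F ^+ t *m x) = F ^+ t.+1 *m x.
Proof. by rewrite mulmxA exprS. Qed.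

Lemma lyap_iter n (F W P : 'M[R]_n) y x t : lyap F W P ->
  bil P y x = \sum_(0 <= s < t) bil W (F ^+ s *m y) (F ^+ s *m x)
              + bil P (F ^+ t *m y) (F ^+ t *m x).
Proof.
move=> eP; elim: t => [|t ->]; first by rewrite big_geq // add0r expr0 !mul1mx.
rewrite big_nat_recr //= -addrA; congr (_ + _).
by rewrite [in LHS]eP bilDm bil_mul !mulmx_exprS.
Qed.

Lemma lyap_series n (F W P : 'M[R]_n) y x : stable F -> lyap F W P ->
  (fun t => \sum_(0 <= s < t) bil W (F ^+ s *m y) (F ^+ s *m x)) @ \oo --> bil P y x.
Proof.
move=> sF eP.
have -> : (fun t => \sum_(0 <= s < t) bil W (F ^+ s *m y) (F ^+ s *m x)) =
          (fun t => bil P y x - bil P (F ^+ t *m y) (F ^+ t *m x)).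
  by apply/funext => t; rewrite [bil P y x](lyap_iter y x t eP) addrK.
rewrite -[X in _ --> X]subr0; apply: cvgB; first exact: cvg_cst.
exact: stable_bil_cvg0.
Qed.

Lemma bil_inj n (P : 'M[R]_n) : (forall y x, bil P y x = 0) -> P = 0.
Proof. by move=> h; apply/matrixP => i j; rewrite -bil_delta h mxE. Qed.

Lemma lyap0_eq0 n (F P : 'M[R]_n) : stable F -> lyap F 0 P -> P = 0.
Proof.
move=> sF eP; apply: bil_inj => y x.
have := @lyap_series _ F _ P y x sF eP.
have -> : (fun t => \sum_(0 <= s < t) bil 0 (F ^+ s *m y) (F ^+ s *m x)) = (fun=> 0 : R).
  by apply/funext => t; apply: big1 => s _; rewrite bil0m.
move=> h; exact: (cvg_unique (@norm_hausdorff _ _) h (cvg_cst 0)).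
Qed.

Lemma lyapB n (F W P W' P' : 'M[R]_n) : lyap F W P -> lyap F W' P' -> lyap F (W - W') (P - P').
Proof.
move=> eP eP'; rewrite /lyap mulmxBr mulmxBl {1}eP {1}eP' opprD !addrA; congr (_ + _).
by rewrite addrAC.
Qed.

Lemma lyapZ n a (F W P : 'M[R]_n) : lyap F W P -> lyap F (a *: W) (a *: P).
Proof. by move=> eP; rewrite /lyap -scalemxAr -scalemxAl -scalerDr -eP. Qed.

Lemma lyapD n (F W P W' P' : 'M[R]_n) : lyap F W P -> lyap F W' P' -> lyap F (W + W') (P + P').
Proof. by move=> eP eP'; rewrite /lyap mulmxDr mulmxDl {1}eP {1}eP' addrACA. Qed.

Lemma lyap_tr n (F W P : 'M[R]_n) : lyap F W P -> lyap F W^T P^T.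
Proof. by move=> eP; rewrite /lyap {1}eP linearD /= !trmx_mul trmxK mulmxA. Qed.

Lemma lyap_unique n (F W P P' : 'M[R]_n) : stable F -> lyap F W P -> lyap F W P' -> P = P'.
Proof.
move=> sF eP eP'; apply/eqP; rewrite -subr_eq0; apply/eqP.
by apply: (lyap0_eq0 sF); rewrite -(subrr W); exact: lyapB.
Qed.

(** Uniqueness says that the linear operator P |-> P - F^T P F is injective, hence
bijective in finite dimension. *)
Lemma lyap_exists n (F W : 'M[R]_n) : stable F -> exists P, lyap F W P.
Proof.
move=> sF.
pose G := 1%:M - lin_mx (mulmxr F \o mulmx F^T).
have GE P : mxvec P *m G = mxvec (P - F^T *m P *m F).
  by rewrite mulmxBr mulmx1 mul_vec_lin linearB.
have uG : G \in unitmx.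
  rewrite -row_free_unit -kermx_eq0; apply/eqP/row_matrixP => i; rewrite row0.
  have : row i (kermx G) *m G = 0 by rewrite -row_mul mulmx_ker row0.
  rewrite -[row i _]vec_mxK GE; set P := vec_mx _ => /eqP.
  rewrite mxvec_eq0 subr_eq0 => /eqP eP.
  by rewrite (@lyap0_eq0 _ F P) ?linear0 // /lyap add0r.
have [P PE] : exists P, mxvec P *m G = mxvec W.
  by exists (vec_mx (mxvec W *m invmx G)); rewrite vec_mxK mulmxKV.
exists P; move: PE; rewrite GE => /(can_inj mxvecK) WE.
by rewrite /lyap -[X in _ = X + _]WE subrK.
Qed.

(** The form of P is a limit of sums of values of the form of W.  Applied to
differences, this is the comparison principle for the Lyapunov equation. *)
Lemma lyap_psd n (F W P : 'M[R]_n) : stable F -> lyap F W P -> psd W -> psd P.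
Proof.
move=> sF eP [eW W0]; split=> [|x].
  by apply: (lyap_unique sF _ eP); rewrite -[W in lyap _ W]eW; exact: lyap_tr.
have h := @lyap_series _ F W P x x sF eP.
apply: (ler_cvg_to (cvg_cst 0) h); near=> t.
by apply: sumr_ge0 => s _; exact: W0.
Unshelve. all: by end_near. Qed.

Lemma lyap_psd_ge n (F W P : 'M[R]_n) : stable F -> lyap F W P -> psd W -> psd (P - W).
Proof.
move=> sF eP pW; rewrite [P in P - _]eP addrAC subrr add0r.
exact/psd_congr/(lyap_psd sF eP).
Qed.

(** The operators P |-> P - F^T P F and X |-> X - F X F^T are adjoint for the
trace pairing. *)
Lemma lyap_duality n (F W P S X : 'M[R]_n) :
  lyap F W P -> lyap F^T S X -> \tr (P *m S) = \tr (W *m X).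
Proof.
rewrite /lyap trmxK => eP eX.
have -> : W = P - F^T *m P *m F by rewrite [P in P - _]eP addrK.
have -> : S = X - F *m X *m F^T by rewrite [X in X - _]eX addrK.
rewrite mulmxBr mulmxBl !linearB /=; congr (_ - _).
by rewrite mulmxA mxtrace_mulC !mulmxA.
Qed.

(** If D lies between - d I and d I, comparison places X between - d Y and d Y,
where Y solves the equation with right-hand side I. *)
Lemma lyap_specnorm_le n (F D X Y : 'M[R]_n) d y : stable F -> lyap F D X -> lyap F 1%:M Y ->
  0 <= d -> D^T = D -> (forall x, `|bil D x x| <= d * bil 1%:M x x) ->
  (forall x, bil Y x x <= y * bil 1%:M x x) -> 0 <= y -> specnorm X <= d * y.
Proof.
move=> sF eX eY d0 eD hD hY y0.
have pDm : psd (d *: 1%:M - D).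
  split=> [|x]; first by rewrite linearB linearZ /= trmx1 eD.
  by rewrite !bilE subr_ge0; exact: le_trans (ler_norm _) (hD x).
have pDp : psd (d *: 1%:M + D).
  split=> [|x]; first by rewrite linearD linearZ /= trmx1 eD.
  rewrite !bilE -[bil D x x]opprK subr_ge0; apply: le_trans (hD x).
  by rewrite -normrN; exact: ler_norm.
have [_ hm] := lyap_psd sF (lyapB (lyapZ d eY) eX) pDm.
have [_ hp] := lyap_psd sF (lyapD (lyapZ d eY) eX) pDp.
apply: specnorm_sym_le; first exact: mulr_ge0.
  by apply: (lyap_unique sF _ eX); rewrite -[D in lyap _ D]eD; exact: lyap_tr.
move=> x; rewrite ler_norml -mulrA.
have h := ler_wpM2l d0 (hY x); have := hm x; have := hp x; rewrite !bilE.
by move=> h1 h2; apply/andP; split; lra.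
Qed.

(** Along a trajectory x^T Y x decreases by at least a |x|^2, hence by the factor
1 - a / (||Y|| + a), and it dominates |x|^2. *)
Lemma lyapunov_stable n (F Y : 'M[R]_n) a : 0 < a ->
  psd (Y - 1%:M) -> psd (Y - F^T *m Y *m F - a *: 1%:M) -> stable F.
Proof.
move=> a0 [_ Y1] [_ YF].
pose V x := bil Y x x.
have V1 x : bil 1%:M x x <= V x by have := Y1 x; rewrite !bilE subr_ge0.
pose y := specnorm Y + a.
have y0 : 0 < y by rewrite ltr_wpDl.
have Vy x : V x <= y * bil 1%:M x x.
  apply: le_trans (ler_norm _) (le_trans (bil_le_specnorm _ _) _).
  by rewrite ler_wpM2r // lerDl ltW.
pose q := 1 - a / y.
have q0 : 0 <= q by rewrite subr_ge0 ler_pdivrMr // mul1r lerDr.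
have q1 : q < 1 by rewrite ltrBlDr ltrDl divr_gt0.
have Vq x : V (F *m x) <= q * V x.
  have := YF x; rewrite !bilE bil_mul -/(V _) -/(V _) => h.
  have : a / y * V x <= a * bil 1%:M x x.
    by rewrite mulrAC ler_pdivrMr // -mulrA ler_pM2l // mulrC.
  by rewrite /q mulrBl mul1r; lra.
have Vt x t : V (F ^+ t *m x) <= q ^+ t * V x.
  elim: t => [|t IH]; first by rewrite !expr0 mul1mx mul1r.
  rewrite -mulmx_exprS; apply: le_trans (Vq _) _.
  by rewrite exprS -mulrA ler_wpM2l.
(* x^T Y x decays at rate q and is quadratic in x, so |x| decays at rate sqrt q *)
exists (Num.sqrt y), (Num.sqrt q); split; rewrite ?sqrtr_ge0 //.
  by rewrite -[ltRHS]sqrtr1 ltr_sqrt.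
move=> t; apply: specnorm_le => [|x]; first by rewrite mulr_ge0 ?exprn_ge0 ?sqrtr_ge0.
rewrite -(@ler_pXn2r _ 2) ?nnegrE ?mulr_ge0 ?exprn_ge0 ?sqrtr_ge0 // !exprMn.
rewrite !enorm_sqr -exprM mulnC exprM !sqr_sqrtr ?(ltW y0) //.
apply: le_trans (V1 _) (le_trans (Vt x t) _).
by rewrite -mulrA [leRHS]mulrCA ler_wpM2l // exprn_ge0.
Qed.

End Lyapunov.

(** * The cost as a trace *)

Section Cost.
Variable R : realType.

Lemma bil_sumE m n (P : 'M[R]_(m, n)) y x :
  bil P y x = \sum_k \sum_l P k l * (y k 0 * x l 0).
Proof.
rewrite /bil mxE exchange_big /=; apply: eq_bigr => l _.
rewrite mxE big_distrl /=; apply: eq_bigr => k _.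
by rewrite !mxE mulrCA mulrA.
Qed.

Lemma measurable_coord n (k : 'I_n) :
  measurable_fun [set: borel_cV R n] (fun x : borel_cV R n => (x : 'cV[R]_n) k 0).
Proof.
apply: (measurability _ (RGenOpens.measurableE R)) => _ [_ [a [b ->] <-]].
rewrite setTI; apply: sub_sigma_algebra.
have /continuousP c : continuous (fun x : 'cV[R]_n => x k 0) by exact: coord_continuous.
exact/c/interval_open.
Qed.

Lemma measurable_bil n (P : 'M[R]_n) :
  measurable_fun [set: borel_cV R n] (fun x : borel_cV R n => bil P (x : 'cV[R]_n) x).
Proof.
under eq_fun do rewrite bil_sumE.
apply: measurable_sum => k; apply: measurable_sum => l.
apply: measurable_funM; first exact: measurable_cst.
by apply: measurable_funM; exact: measurable_coord.
Qed.

Variables (n : nat) (D : probability (borel_cV R n) R) (H : R).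
Hypothesis DH : {ae D, forall x0 : borel_cV R n, enorm (x0 : 'cV[R]_n) <= H}.

(** Second moments exist because the initial state is almost surely bounded. *)
Lemma integrable_coordM (k l : 'I_n) :
  D.-integrable [set: borel_cV R n]
    (fun x : borel_cV R n => ((x : 'cV[R]_n) k 0 * (x : 'cV[R]_n) l 0)%:E).
Proof.
have mkl : measurable_fun [set: borel_cV R n]
    (fun x : borel_cV R n => ((x : 'cV[R]_n) k 0 * (x : 'cV[R]_n) l 0)%:E).
  by apply/measurable_EFinP; apply: measurable_funM; exact: measurable_coord.
apply/integrableP; split=> //.
apply: (@le_lt_trans _ _ (\int[D]_(x in setT) (H ^+ 2)%:E)%E).
  apply: ae_ge0_le_integral => //.
  - exact: measurableT_comp.
  - by move=> x _; rewrite lee_fin sqr_ge0.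
  - apply: filterS DH => x xH _; rewrite lee_fin normrM expr2.
    have h j := le_trans (entry_le_enorm (x : 'cV[R]_n) j) xH.
    by apply: ler_pM.
by rewrite integral_cst //= probability_setT mule1 ltry.
Qed.

Lemma integral_bil (P : 'M[R]_n) :
  (\int[D]_x (bil P (x : 'cV[R]_n) x)%:E)%E = (\tr (P *m second_moment D))%:E.
Proof.
pose f k l (x : borel_cV R n) := ((x : 'cV[R]_n) k 0 * (x : 'cV[R]_n) l 0)%:E.
have f_int k l : (\int[D]_x f k l x)%E = (second_moment D k l)%:E.
  rewrite mxE unlock fineK; last first.
    have -> : (fun x : borel_cV R n => (((x : 'cV[R]_n) *m (x : 'cV[R]_n)^T) k l)%:E) = f k l.
      by apply/funext => x; rewrite mxE big_ord1 mxE.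
    by apply: integrable_fin_num => //; exact: integrable_coordM.
  by apply: eq_integral => x _; rewrite mxE big_ord1 [in RHS]mxE.
have fP k l : D.-integrable setT (fun x => (P k l)%:E * f k l x)%E.
  by apply: integrableZl => //; exact: integrable_coordM.
transitivity (\int[D]_x (\sum_k \sum_l (P k l)%:E * f k l x))%E.
  apply: eq_integral => x _; rewrite bil_sumE -sumEFin; apply: eq_bigr => k _.
  by rewrite -sumEFin; apply: eq_bigr => l _; rewrite EFinM.
rewrite integral_sum //; last by move=> k; apply: integrable_sum.
rewrite /mxtrace -sumEFin; apply: eq_bigr => k _.
rewrite integral_sum // mxE -sumEFin; apply: eq_bigr => l _.
rewrite integralZl //; last exact: integrable_coordM.
rewrite f_int -EFinM; congr ((_ * _)%:E).
rewrite !mxE; congr (fine 'E_D[ _ ]); apply/funext => x.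
by rewrite !mxE !big_ord1 !mxE mulrC.
Qed.

(** The form at y is the mean of (y^T x)^2, the instance of integral_bil for the
matrix y y^T. *)
Lemma second_moment_psd : psd (second_moment D).
Proof.
split=> [|y].
  apply/matrixP => k l; rewrite !mxE; congr (fine 'E_D[ _ ]); apply/funext => x.
  by rewrite !mxE !big_ord1 !mxE mulrC.
have -> : bil (second_moment D) y y = \tr (y *m y^T *m second_moment D).
  by rewrite -mulmxA mxtrace_mulC trace_mx11.
rewrite -lee_fin -integral_bil; apply: integral_ge0 => x _.
by rewrite lee_fin; exact: (psd_rank1 y).2.
Qed.

Variables (nu : nat) (Q : 'M[R]_n) (Ru : 'M[R]_nu) (A : 'M[R]_n) (B : 'M[R]_(n, nu)).
Hypotheses (pQ : psd Q) (pR : psd Ru).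

(** The stage cost under the feedback u = - K x is the form of this matrix at x. *)
Definition weight (K : 'M[R]_(nu, n)) : 'M[R]_n := Q + K^T *m Ru *m K.

Lemma weight_psd K : psd (weight K).
Proof. by apply: psdD => //; exact: psd_congr. Qed.

Lemma stateE K x t : state A B K x t = (A - B *m K) ^+ t *m x.
Proof.
elim: t => [|t IH]; first by rewrite expr0 mul1mx.
rewrite [LHS]/= -/(state A B K x t) IH -mulmx_exprS /input mulmxN mulmxBl.
by rewrite !mulmxA.
Qed.

Lemma stage_costE K x t : stage_cost Q Ru (state A B K x t) (input K (state A B K x t))
  = bil (weight K) ((A - B *m K) ^+ t *m x) ((A - B *m K) ^+ t *m x).
Proof.
rewrite stateE /stage_cost /input bilDm bil_mul; set z := _ *m x.
by congr (_ + _); rewrite -[RHS]/(bil _ _ _) -[LHS]/(bil _ _ _) bilNl bilNr opprK.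
Qed.

Lemma costE K :
  cost Q Ru D A B K = (\int[D]_x \sum_(0 <= t <oo)
    (bil (weight K) ((A - B *m K) ^+ t *m (x : 'cV[R]_n))
                    ((A - B *m K) ^+ t *m (x : 'cV[R]_n)))%:E)%E.
Proof.
apply: eq_integral => x _; apply: eq_eseriesr => t _.
by rewrite stage_costE.
Qed.

Lemma cost_ge0 K : (0 <= cost Q Ru D A B K)%E.
Proof.
rewrite costE; apply: integral_ge0 => x _; apply: nneseries_ge0 => t _ _.
by rewrite lee_fin; exact: (weight_psd K).2.
Qed.

(** The series of stage costs sums pointwise to x0^T P x0, whose mean is a trace. *)
Lemma cost_stable K P : stable (A - B *m K) -> lyap (A - B *m K) (weight K) P ->
  cost Q Ru D A B K = (\tr (P *m second_moment D))%:E.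
Proof.
move=> sF eP; rewrite costE -integral_bil; apply: eq_integral => x _.
have := @lyap_series _ _ _ _ _ (x : 'cV[R]_n) (x : 'cV[R]_n) sF eP => h.
apply/cvg_lim => //; under eq_fun do rewrite sumEFin.
by apply: cvg_EFin => //; exact: nearW.
Qed.

(** The first stage cost alone bounds the cost from below, whether or not K is
stabilizing. *)
Lemma cost_ge_weight K : ((\tr (weight K *m second_moment D))%:E <= cost Q Ru D A B K)%E.
Proof.
rewrite costE -integral_bil; apply: ge0_le_integral => //.
- by move=> x _; rewrite lee_fin; exact: (weight_psd K).2.
- apply/measurable_EFinP; exact: measurable_bil.
- apply: ge0_emeasurable_sum => [t x _ _|t _].
    by rewrite lee_fin; exact: (weight_psd K).2.
  apply/measurable_EFinP; under eq_fun do rewrite -bil_mul.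
  exact: measurable_bil.
move=> x _.
apply: le_trans (nneseries_lim_ge 1 _) => [|t _ _]; last first.
  by rewrite lee_fin; exact: (weight_psd K).2.
by rewrite big_nat1 expr0 mul1mx.
Qed.

End Cost.

(** * Perturbation of the Lyapunov equation *)

Section Perturbation.
Variable R : realType.

Lemma congr_affine m n (S : 'M[R]_m) (X Y : 'M[R]_(m, n)) h :
  (X + h *: Y)^T *m S *m (X + h *: Y) =
  X^T *m S *m X + h *: (Y^T *m S *m X + X^T *m S *m Y) + h ^+ 2 *: (Y^T *m S *m Y).
Proof.
have -> : (X + h *: Y)^T = X^T + h *: Y^T by rewrite linearD linearZ.
rewrite !mulmxDl !mulmxDr -!scalemxAl -!scalemxAr scalerA -expr2.
by rewrite scalerDr !addrA; congr (_ + _); rewrite addrAC.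
Qed.

Lemma bil_affine_bound n (S T : 'M[R]_n) h x : `|h| <= 1 ->
  `|bil (h *: S + h ^+ 2 *: T) x x| <= `|h| * (specnorm S + specnorm T) * bil 1%:M x x.
Proof.
move=> h1; rewrite !bilE.
apply: le_trans (ler_normD _ _) _; rewrite !normrM mulrDr mulrDl.
apply: lerD; rewrite -mulrA.
  by rewrite ler_wpM2l // bil_le_specnorm.
rewrite -[leRHS]mulrA ler_wpM2l //; apply: le_trans (bil_le_specnorm T x).
by rewrite ler_piMl.
Qed.

(** The solution Y for the right-hand side I at G satisfies
G'^T Y G' <= Y - I / 2 for G' = G + h N and small h.  Hence G' is stable, and
its own solution for the right-hand side I is at most 2 Y.  The difference
X' - X solves the equation at G' with right-hand side G'^T X G' - G^T X G,
which is of order h. *)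
Lemma lyap_perturbation n (G N S X : 'M[R]_n) : stable G -> S^T = S -> lyap G S X ->
  exists h0 c, [/\ 0 < h0, 0 <= c & forall h, `|h| < h0 ->
    stable (G + h *: N) /\
    forall X', lyap (G + h *: N) S X' -> specnorm (X' - X) <= `|h| * c].
Proof.
move=> sG eS eX.
have [Y eY] := lyap_exists 1%:M sG.
have pY := lyap_psd sG eY (psd1 R n).
have pY1 := lyap_psd_ge sG eY (psd1 R n).
have eXT : X^T = X.
  by apply: (lyap_unique sG _ eX); rewrite -[S in lyap _ S]eS; exact: lyap_tr.
pose T1 := N^T *m Y *m G + G^T *m Y *m N; pose T2 := N^T *m Y *m N.
pose U1 := N^T *m X *m G + G^T *m X *m N; pose U2 := N^T *m X *m N.
pose t := specnorm T1 + specnorm T2; pose u := specnorm U1 + specnorm U2.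
have t0 : 0 <= t by rewrite addr_ge0.
have u0 : 0 <= u by rewrite addr_ge0.
(* this radius gives both |h| <= 1 and |h| t <= 1 / 2 *)
exists (2 * t + 1)^-1, (u * (2 * specnorm Y)); split.
- by rewrite invr_gt0 ltr_wpDl // mulr_ge0.
- by rewrite !mulr_ge0.
move=> h hh0; set G' := G + h *: N.
have ht : `|h| * (2 * t + 1) < 1.
  by rewrite -ltr_pdivlMr ?ltr_wpDl ?mulr_ge0 // mul1r.
have h0 := normr_ge0 h.
have h1 : `|h| <= 1 by nra.
have ht2 : `|h| * t <= 1 / 2 by nra.
have G'Y : Y - G'^T *m Y *m G' = 1%:M - (h *: T1 + h ^+ 2 *: T2).
  by rewrite congr_affine {1}eY !opprD !addrA addrK.
have pYh : psd (Y - G'^T *m Y *m G' - 2^-1 *: 1%:M).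
  split=> [|x].
    by rewrite !linearB linearZ /= !trmx_mul !trmxK trmx1 pY.1 mulmxA.
  rewrite G'Y bilDm bilNm bilDm bilNm bilZm.
  have := le_trans (ler_norm _) (bil_affine_bound T1 T2 x h1); rewrite -/t => hb.
  by have := ler_wpM2r (bil1_ge0 x) ht2; lra.
have sG' : stable G' by apply: (lyapunov_stable _ pY1 pYh); rewrite invr_gt0.
split=> // X' eX'.
have [Y' eY'] := lyap_exists 1%:M sG'.
have pY' : psd (2 *: Y - Y').
  have e2 : lyap G' (2 *: (Y - G'^T *m Y *m G') - 1%:M) (2 *: Y - Y').
    by apply: lyapB => //; apply: lyapZ; rewrite /lyap subrK.
  apply: (lyap_psd sG' e2).
  have := psdZ (ler0n R 2) pYh; rewrite scalerBr scalerA divff ?pnatr_eq0 // scale1r; exact.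
have eD : lyap G' (h *: U1 + h ^+ 2 *: U2) (X' - X).
  rewrite /lyap mulmxBr mulmxBl {1}eX' {1}eX.
  rewrite [X in _ + (_ - X)]congr_affine -/U1 -/U2.
  set a := G'^T *m _ *m _; set b := G^T *m X *m G; set v := h *: _; set w := _ *: _.
  by rewrite !opprD !addrA; apply/matrixP => i j; rewrite !mxE; ring.
rewrite [leRHS](mulrA `|h| u); apply: (lyap_specnorm_le sG' eD eY'); rewrite ?mulr_ge0 //.
- rewrite linearD !linearZ /= linearD /= !trmx_mul !trmxK eXT !mulmxA.
  by rewrite [_ *m N + _]addrC.
- move=> x; exact: (bil_affine_bound U1 U2 x h1).
move=> x; have := pY'.2 x; rewrite !bilE subr_ge0 => /le_trans; apply.
rewrite -mulrA ler_wpM2l //; exact: le_trans (ler_norm _) (bil_le_specnorm _ _).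
Qed.

Lemma mxtrace_deltaM m n (M : 'M[R]_(m, n)) a b : \tr ((delta_mx a b)^T *m M) = M a b.
Proof.
rewrite trmx_delta -(mul_delta_mx (0 : 'I_1)) -mulmxA mxtrace_mulC trace_mx11.
by rewrite -[RHS]bil_delta /bil trmx_delta.
Qed.

Lemma derive_of_linear_error (V : normedModType R) (f : V -> R) (K v : V) l h0 c :
  0 < h0 -> 0 <= c ->
  (forall h, h != 0 -> `|h| < h0 -> `|h^-1 * (f (h *: v + K) - f K) - l| <= `|h| * c) ->
  'D_v f K = l.
Proof.
move=> h00 c0 hf; apply/cvg_lim => //; apply/cvgrPdist_le => e e0.
have e1 : 0 < Num.min h0 (e / (c + 1)) by rewrite lt_min h00 divr_gt0 // ltr_wpDl.
near=> h.
have hn : h != 0 by near: h; exact: nbhs_dnbhs_neq.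
have : `|h| < Num.min h0 (e / (c + 1)) by near: h; exact: dnbhs0_lt.
rewrite lt_min => /andP [hh0 he]; rewrite distrC.
apply: le_trans (hf h hn hh0) _.
rewrite ltr_pdivlMr ?ltr_wpDl // in he.
by have := normr_ge0 h; nra.
Unshelve. all: by end_near. Qed.

End Perturbation.

(** * The policy gradient *)

Section GradientFormula.
Variable R : realType.

Variables (n nu : nat) (A : 'M[R]_n) (B : 'M[R]_(n, nu)) (Q : 'M[R]_n) (Ru : 'M[R]_nu).

(** The factor E of the policy gradient 2 E X. *)
Definition grad_factor (P : 'M[R]_n) (K : 'M[R]_(nu, n)) : 'M[R]_(nu, n) :=
  Ru *m K - B^T *m P *m (A - B *m K).

(** At K + h V the increment P' - P solves the Lyapunov equation of the perturbed
closed loop with right-hand side W' - W + F'^T P F' - F^T P F; this is an exact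
polynomial in h, and its linear part is V^T E + E^T V. *)
Lemma lyap_increment (P P' : 'M[R]_n) (K V : 'M[R]_(nu, n)) h :
  Ru^T = Ru -> P^T = P ->
  lyap (A - B *m K) (weight Q Ru K) P ->
  lyap (A - B *m (K + h *: V)) (weight Q Ru (K + h *: V)) P' ->
  lyap (A - B *m (K + h *: V))
    (h *: (V^T *m grad_factor P K + (grad_factor P K)^T *m V)
     + h ^+ 2 *: (V^T *m (Ru + B^T *m P *m B) *m V)) (P' - P).
Proof.
move=> eR eP.
set E := grad_factor P K; set F := A - B *m K; set F' := A - B *m (K + _).
have F'E : F' = F + h *: - (B *m V).
  by rewrite /F' mulmxDr opprD addrA -scalemxAr scalerN.
rewrite /lyap => lP lP'.
have WE := congr_affine Ru K V h.
have FE := congr_affine P F (- (B *m V)) h.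
rewrite -F'E in FE.
have ET : E^T = K^T *m Ru - F^T *m P *m B.
  by rewrite /E /grad_factor linearB /= !trmx_mul trmxK eR eP mulmxA.
have BVT : (- (B *m V))^T = - (V^T *m B^T) by rewrite linearN /= trmx_mul.
have e1 : V^T *m E + E^T *m V = (V^T *m Ru *m K + K^T *m Ru *m V)
    + ((- (B *m V))^T *m P *m F + F^T *m P *m (- (B *m V))).
  rewrite ET /E /grad_factor -/F mulmxBr mulmxBl BVT !mulNmx mulmxN !mulmxA.
  by rewrite addrACA.
have e2 : V^T *m (Ru + B^T *m P *m B) *m V = V^T *m Ru *m V
    + (- (B *m V))^T *m P *m (- (B *m V)).
  by rewrite BVT !mulNmx !mulmxN opprK mulmxDr mulmxDl !mulmxA.
rewrite [F'^T *m (P' - P)]mulmxBr [(_ - _) *m F']mulmxBl FE e1 e2.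
rewrite [X in X - _ = _]lP' [X in _ - X = _]lP /weight WE.
apply/matrixP => i j; rewrite !mxE; ring.
Qed.

Variables (D : probability (borel_cV R n) R) (H : R).
Hypothesis DH : {ae D, forall x0 : borel_cV R n, enorm (x0 : 'cV[R]_n) <= H}.
Hypotheses (pQ : psd Q) (pR : psd Ru).

(** By duality the cost increment from K to K + h V is the trace of the
right-hand side of lyap_increment against the covariance X' at K + h V.
Dividing by h leaves 2 tr(V^T E X') up to O(h), and X' tends to X. *)
Lemma grad_costE (K : 'M[R]_(nu, n)) P X :
  stable (A - B *m K) -> lyap (A - B *m K) (weight Q Ru K) P ->
  lyap (A - B *m K)^T (second_moment D) X ->
  grad_cost Q Ru D A B K = 2 *: (grad_factor P K *m X).
Proof.
move=> sF eP eX; set E := grad_factor P K; set F := A - B *m K in sF eP eX.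
have pW := weight_psd pQ pR K.
have pP := lyap_psd sF eP pW.
have pS := second_moment_psd DH.
apply/matrixP => a b; rewrite !mxE; set V : 'M[R]_(nu, n) := delta_mx a b.
set N := (Ru + B^T *m P *m B) *m V.
have [h0 [c [h00 c0 hX]]] := lyap_perturbation (- (B *m V))^T (stable_tr sF) pS.1 eX.
pose k := 2 * (specnorm E * c) + specnorm N * (specnorm X + h0 * c).
have -> : \sum_j E a j * X j b = (E *m X) a b by rewrite mxE.
have k0 : 0 <= k by rewrite addr_ge0 // !mulr_ge0 // addr_ge0 // mulr_ge0 // ltW.
apply: (derive_of_linear_error h00 k0) => h hn hh.
have [sFh hXX] := hX h hh.
rewrite [h *: V + K]addrC; set F' := A - B *m (K + h *: V).
have F'E : F' = F + h *: - (B *m V).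
  by rewrite /F' mulmxDr opprD addrA -scalemxAr scalerN.
have F'T : F^T + h *: (- (B *m V))^T = F'^T by rewrite F'E; apply/matrixP => i j; rewrite !mxE.
rewrite F'T in sFh hXX.
have sF' : stable F' by rewrite -[F']trmxK; exact: stable_tr.
have [P' eP'] := lyap_exists (weight Q Ru (K + h *: V)) sF'.
have [X' eX'] := lyap_exists (second_moment D) sFh.
have {}hXX := hXX X' eX'.
have symX' : X'^T = X' by case: (lyap_psd sFh eX' pS).
rewrite (cost_stable DH sF' eP') (cost_stable DH sF eP) /=.
have -> : \tr (P' *m second_moment D) - \tr (P *m second_moment D) =
    h * (2 * (E *m X') a b) + h ^+ 2 * (N *m X') a b.
  rewrite -linearB /= -mulmxBl.
  rewrite (lyap_duality (lyap_increment pR.1 pP.1 eP eP') eX').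
  rewrite mulmxDl -!scalemxAl linearD !linearZ /= mulmxDl linearD /=.
  rewrite -!mulmxA !mxtrace_deltaM -/N.
  have -> : \tr (E^T *m (V *m X')) = (E *m X') a b.
    rewrite -mxtrace_tr !trmx_mul trmxK symX' -mulmxA mxtrace_mulC -mulmxA.
    exact: mxtrace_deltaM.
  by rewrite mulr2n mulrDl mul1r.
have -> : h^-1 * (h * (2 * (E *m X') a b) + h ^+ 2 * (N *m X') a b) - 2 * (E *m X) a b =
    2 * (E *m (X' - X)) a b + h * (N *m X') a b.
  have -> : (E *m (X' - X)) a b = (E *m X') a b - (E *m X) a b.
    by rewrite mulmxBr; set U := _ *m _; set U' := _ *m X; rewrite !mxE.
  by field.
have nX' : specnorm X' <= specnorm X + h0 * c.
  rewrite -[X'](subrK X) addrC; apply: le_trans (specnormD _ _) _.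
  by rewrite lerD2l; apply: le_trans hXX _; rewrite ler_wpM2r // ltW.
apply: le_trans (ler_normD _ _) _; rewrite !normrM mulrDr.
apply: lerD.
  rewrite mulrCA ger0_norm // ler_wpM2l // [leRHS]mulrCA.
  apply: le_trans (entry_le_specnorm _ _ _) (le_trans (specnormM _ _) _).
  exact: ler_wpM2l.
rewrite ler_wpM2l //.
apply: le_trans (entry_le_specnorm _ _ _) (le_trans (specnormM _ _) _).
exact: ler_wpM2l.
Qed.

End GradientFormula.

(** * Heterogeneity of the gradients *)

Section Heterogeneity.
Variable R : realType.

(** P dominates w times the solution with right-hand side I. *)
Lemma lyap_identity_le n (F W P Y : 'M[R]_n) w x : stable F -> 0 < w ->
  psd (W - w *: 1%:M) -> lyap F W P -> lyap F 1%:M Y ->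
  bil Y x x <= specnorm P / w * bil 1%:M x x.
Proof.
move=> sF w0 pW eP eY.
have := (lyap_psd sF (lyapB eP (lyapZ w eY)) pW).2 x; rewrite !bilE subr_ge0 => h.
rewrite mulrAC ler_pdivlMr // mulrC; apply: le_trans h _.
exact: le_trans (ler_norm _) (bil_le_specnorm _ _).
Qed.

(** The difference P1 - P2 solves the equation at F1 with right-hand side
F1^T P2 F1 - F2^T P2 F2, which telescopes into two terms of size e p al. *)
Lemma lyap_difference_le n (F1 F2 W P1 P2 : 'M[R]_n) w al e p :
  stable F1 -> 0 < w -> psd (W - w *: 1%:M) ->
  lyap F1 W P1 -> lyap F2 W P2 -> P2^T = P2 ->
  specnorm F1 <= al -> specnorm F2 <= al -> specnorm (F1 - F2) <= e ->
  specnorm P1 <= p -> specnorm P2 <= p ->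
  specnorm (P1 - P2) <= 2 * al * e * p * (p / w).
Proof.
move=> sF1 w0 pW eP1 eP2 sP2 hF1 hF2 hF hP1 hP2.
have [Y eY] := lyap_exists 1%:M sF1.
have al0 : 0 <= al := le_trans (specnorm_ge0 _) hF1.
have e0 : 0 <= e := le_trans (specnorm_ge0 _) hF.
have p0 : 0 <= p := le_trans (specnorm_ge0 _) hP1.
pose Delta := F1^T *m P2 *m F1 - F2^T *m P2 *m F2.
have eD : lyap F1 Delta (P1 - P2).
  rewrite /lyap [F1^T *m (P1 - P2)]mulmxBr [(_ - _) *m F1]mulmxBl /Delta.
  rewrite [X in X - _ = _]eP1 [X in _ - X = _]eP2.
  by apply/matrixP => i j; rewrite !mxE; ring.
have DE : Delta = (F1 - F2)^T *m P2 *m F1 + F2^T *m P2 *m (F1 - F2).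
  have -> : (F1 - F2)^T = F1^T - F2^T by apply/matrixP => i j; rewrite !mxE.
  by rewrite /Delta !mulmxBl mulmxBr addrA subrK.
have nD : specnorm Delta <= 2 * al * e * p.
  have -> : 2 * al * e * p = e * p * al + al * p * e by ring.
  rewrite DE; apply: le_trans (specnormD _ _) (lerD _ _).
    apply: le_trans (specnormM _ _) (ler_pM _ _ _ hF1) => //.
    apply: le_trans (specnormM _ _) (ler_pM _ _ _ hP2) => //.
    exact: le_trans (specnorm_tr _) hF.
  apply: le_trans (specnormM _ _) (ler_pM _ _ _ hF) => //.
  apply: le_trans (specnormM _ _) (ler_pM _ _ _ hP2) => //.
  exact: le_trans (specnorm_tr _) hF2.
apply: (lyap_specnorm_le sF1 eD eY); rewrite ?mulr_ge0 ?invr_ge0 ?(ltW w0) //.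
- have trBE (U V : 'M[R]_n) : (U - V)^T = U^T - V^T.
    by apply/matrixP => i j; rewrite !mxE.
  by rewrite trBE !trmx_mul !trmxK sP2 !mulmxA.
- by move=> x; apply: le_trans (bil_le_specnorm _ _) _; rewrite ler_wpM2r.
move=> x; apply: le_trans (lyap_identity_le x sF1 w0 pW eP1 eY) _.
by rewrite ler_wpM2r // ler_wpM2r // invr_ge0 ltW.
Qed.

Lemma mulmx_difference m n p (E1 E2 : 'M[R]_(m, n)) (X1 X2 : 'M[R]_(n, p)) :
  E1 *m X1 - E2 *m X2 = (E1 - E2) *m X1 + E2 *m (X1 - X2).
Proof. by rewrite mulmxBl mulmxBr addrA subrK. Qed.

Lemma mulmx3_difference m n p q (U1 U2 : 'M[R]_(m, n)) (P1 P2 : 'M[R]_(n, p))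
    (F1 F2 : 'M[R]_(p, q)) :
  U1 *m P1 *m F1 - U2 *m P2 *m F2 =
  (U1 - U2) *m P1 *m F1 + U2 *m (P1 - P2) *m F1 + U2 *m P2 *m (F1 - F2).
Proof. by rewrite !(mulmxBl, mulmxBr) !addrA !subrK. Qed.

Lemma grad_factor_difference n nu (A1 A2 : 'M[R]_n) (B1 B2 : 'M[R]_(n, nu)) (Ru : 'M[R]_nu)
    (P1 P2 : 'M[R]_n) K :
  grad_factor A1 B1 Ru P1 K - grad_factor A2 B2 Ru P2 K =
  - ((B1^T - B2^T) *m P1 *m (A1 - B1 *m K) + B2^T *m (P1 - P2) *m (A1 - B1 *m K)
     + B2^T *m P2 *m ((A1 - B1 *m K) - (A2 - B2 *m K))).
Proof. by rewrite -mulmx3_difference /grad_factor !opprB addrC addrA subrK. Qed.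

(** Here a, b, r, k bound ||A||, ||B||, ||Ru||, ||K||, and C bounds the costs; then
al bounds the closed loops, v and s bound the value and covariance matrices,
and c is the factor lost in solving a Lyapunov equation.  The summands
correspond to E1 - E2 multiplied by X1 and to E2 multiplied by X1 - X2. *)
Definition het_gain (a b r mu sg k C : R) : R :=
  let al := a + b * k in let v := C / mu in let s := C / sg in let c := C / (mu * sg) in
  2 * ((2 * b * al ^+ 2 * v * c + b * v) * s + (r * k + b * v * al) * (2 * al * s * c)).

(** The part of the difference of the gradients that comes from B1 - B2 directly,
not through the closed loops. *)
Definition het_gain_input (a b mu sg k C : R) : R :=
  2 * (C / mu * (a + b * k) * (C / sg)).

Lemma het_gain_ge0 a b r mu sg k C :
  0 <= a -> 0 <= b -> 0 <= r -> 0 < mu -> 0 < sg -> 0 <= k -> 0 <= C ->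
  0 <= het_gain a b r mu sg k C.
Proof.
move=> a0 b0 r0 /ltW mu0 /ltW sg0 k0 C0; rewrite /het_gain.
by do !(apply: addr_ge0 || apply: mulr_ge0 || apply: exprn_ge0 || rewrite invr_ge0 || done).
Qed.

Lemma het_gain_input_ge0 a b mu sg k C :
  0 <= a -> 0 <= b -> 0 < mu -> 0 < sg -> 0 <= k -> 0 <= C ->
  0 <= het_gain_input a b mu sg k C.
Proof.
move=> a0 b0 /ltW mu0 /ltW sg0 k0 C0; rewrite /het_gain_input.
by do !(apply: addr_ge0 || apply: mulr_ge0 || apply: exprn_ge0 || rewrite invr_ge0 || done).
Qed.

Lemma het_gain_le a b r mu sg k C k' C' :
  0 <= a -> 0 <= b -> 0 <= r -> 0 < mu -> 0 < sg -> 0 <= k -> 0 <= C -> k <= k' -> C <= C' ->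
  het_gain a b r mu sg k C <= het_gain a b r mu sg k' C'.
Proof.
move=> a0 b0 r0 /ltW mu0 /ltW sg0 k0 C0 kk CC; rewrite /het_gain !expr2.
by do !(apply: lerD || apply: ler_pM || apply: addr_ge0 || apply: mulr_ge0 || apply: exprn_ge0
        || rewrite invr_ge0 || done).
Qed.

Lemma het_gain_input_le a b mu sg k C k' C' :
  0 <= a -> 0 <= b -> 0 < mu -> 0 < sg -> 0 <= k -> 0 <= C -> k <= k' -> C <= C' ->
  het_gain_input a b mu sg k C <= het_gain_input a b mu sg k' C'.
Proof.
move=> a0 b0 /ltW mu0 /ltW sg0 k0 C0 kk CC; rewrite /het_gain_input.
by do !(apply: lerD || apply: ler_pM || apply: addr_ge0 || apply: mulr_ge0
        || rewrite invr_ge0 || done).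
Qed.

(** The closed loops differ by at most e = eps1 + eps2 ||K||.  Splitting the
products and inserting the bounds on P_i, X_i and their differences gives
e times het_gain plus eps2 times het_gain_input. *)
Lemma grad_cost_difference_le n nu (A1 A2 : 'M[R]_n) (B1 B2 : 'M[R]_(n, nu))
    (Q : 'M[R]_n) (Ru : 'M[R]_nu) (D : probability (borel_cV R n) R) (H : R)
    (K : 'M[R]_(nu, n)) (a b C sg mu eps1 eps2 : R) :
  {ae D, forall x0 : borel_cV R n, enorm (x0 : 'cV[R]_n) <= H} ->
  psd Q -> psd Ru -> 0 < mu -> 0 < sg ->
  psd (second_moment D - mu *: 1%:M) -> psd (Q - sg *: 1%:M) ->
  stable (A1 - B1 *m K) -> stable (A2 - B2 *m K) ->
  specnorm A1 <= a -> specnorm A2 <= a -> specnorm B1 <= b -> specnorm B2 <= b ->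
  specnorm (A1 - A2) <= eps1 -> specnorm (B1 - B2) <= eps2 ->
  fine (cost Q Ru D A1 B1 K) <= C -> fine (cost Q Ru D A2 B2 K) <= C ->
  specnorm (grad_cost Q Ru D A1 B1 K - grad_cost Q Ru D A2 B2 K)
    <= eps1 * het_gain a b (specnorm Ru) mu sg (specnorm K) C
       + eps2 * (specnorm K * het_gain a b (specnorm Ru) mu sg (specnorm K) C
                 + het_gain_input a b mu sg (specnorm K) C).
Proof.
move=> DH pQ pR mu0 sg0 pSmu pQsg sF1 sF2 hA1 hA2 hB1 hB2 hA hB hC1 hC2.
have pS := second_moment_psd DH.
have pW := weight_psd pQ pR K.
have pWsg : psd (weight Q Ru K - sg *: 1%:M).
  by rewrite /weight addrAC; apply: psdD pQsg (psd_congr K pR).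
set k := specnorm K; pose al := a + b * k; pose e := eps1 + eps2 * k.
pose p := C / mu; pose s := C / sg.
have k0 : 0 <= k by exact: specnorm_ge0.
have b0 : 0 <= b := le_trans (specnorm_ge0 _) hB1.
have a0 : 0 <= a := le_trans (specnorm_ge0 _) hA1.
have e10 : 0 <= eps1 := le_trans (specnorm_ge0 _) hA.
have e20 : 0 <= eps2 := le_trans (specnorm_ge0 _) hB.
have solve (A : 'M[R]_n) (B : 'M[R]_(n, nu)) : stable (A - B *m K) ->
    specnorm A <= a -> specnorm B <= b -> fine (cost Q Ru D A B K) <= C ->
    exists P X, [/\ lyap (A - B *m K) (weight Q Ru K) P,
      lyap (A - B *m K)^T (second_moment D) X, psd P, psd X
      & [/\ specnorm P <= p, specnorm X <= s, specnorm (A - B *m K) <= al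
      & grad_cost Q Ru D A B K = 2 *: (grad_factor A B Ru P K *m X)]].
  move=> sF hA' hB' hC.
  have [P eP] := lyap_exists (weight Q Ru K) sF.
  have [X eX] := lyap_exists (second_moment D) (stable_tr sF).
  have pP := lyap_psd sF eP pW; have pX := lyap_psd (stable_tr sF) eX pS.
  rewrite (cost_stable DH sF eP) /= in hC.
  exists P, X; split=> //; split.
  - apply: le_trans (psd_specnorm_le_trace mu0 pP pSmu) _.
    by rewrite ler_wpM2r // invr_ge0 ltW.
  - apply: le_trans (psd_specnorm_le_trace sg0 pX pWsg) _.
    by rewrite mxtrace_mulC -(lyap_duality eP eX) ler_wpM2r // invr_ge0 ltW.
  - apply: le_trans (specnormD _ _) (lerD hA' _); apply: le_trans (specnormN _) _.
    by apply: le_trans (specnormM _ _) _; rewrite ler_wpM2r.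
  exact: (grad_costE DH pQ pR sF eP eX).
have [P1 [X1 [eP1 eX1 pP1 pX1 [nP1 nX1 nF1 ->]]]] := solve _ _ sF1 hA1 hB1 hC1.
have [P2 [X2 [eP2 eX2 pP2 pX2 [nP2 nX2 nF2 ->]]]] := solve _ _ sF2 hA2 hB2 hC2.
have al0 : 0 <= al := le_trans (specnorm_ge0 _) nF1.
have p0 : 0 <= p := le_trans (specnorm_ge0 _) nP1.
have s0 : 0 <= s := le_trans (specnorm_ge0 _) nX1.
set F1 := A1 - B1 *m K in sF1 eP1 eX1 nF1; set F2 := A2 - B2 *m K in sF2 eP2 eX2 nF2.
have nF : specnorm (F1 - F2) <= e.
  have -> : F1 - F2 = (A1 - A2) - (B1 - B2) *m K.
    by rewrite mulmxBl; apply/matrixP => i j; rewrite !mxE; ring.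
  apply: le_trans (specnormD _ _) (lerD hA _); apply: le_trans (specnormN _) _.
  by apply: le_trans (specnormM _ _) _; rewrite ler_wpM2r.
have e0 : 0 <= e := le_trans (specnorm_ge0 _) nF.
have nP := lyap_difference_le sF1 sg0 pWsg eP1 eP2 pP2.1 nF1 nF2 nF nP1 nP2.
have nX : specnorm (X1 - X2) <= 2 * al * e * s * (s / mu).
  apply: (lyap_difference_le (stable_tr sF1) mu0 pSmu eX1 eX2 pX2.1) => //.
  - exact: le_trans (specnorm_tr _) nF1.
  - exact: le_trans (specnorm_tr _) nF2.
  have -> : F1^T - F2^T = (F1 - F2)^T by apply/matrixP => i j; rewrite !mxE.
  exact: le_trans (specnorm_tr _) nF.
set E1 := grad_factor A1 _ _ _ _; set E2 := grad_factor A2 _ _ _ _.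
have nE2 : specnorm E2 <= specnorm Ru * k + b * p * al.
  apply: le_trans (specnormD _ _) (lerD (specnormM _ _) _).
  apply: le_trans (specnormN _) _.
  apply: le_trans (specnormM _ _) (ler_pM _ _ _ nF2) => //.
  apply: le_trans (specnormM _ _) (ler_pM _ _ _ nP2) => //.
  exact: le_trans (specnorm_tr _) hB2.
have nE : specnorm (E1 - E2) <= eps2 * p * al + b * (2 * al * e * p * (p / sg)) * al + b * p * e.
  rewrite grad_factor_difference -/F1 -/F2; apply: le_trans (specnormN _) _.
  apply: le_trans (specnormD _ _) (lerD (le_trans (specnormD _ _) (lerD _ _)) _).
  - apply: le_trans (specnormM _ _) (ler_pM _ _ _ nF1) => //.
    apply: le_trans (specnormM _ _) (ler_pM _ _ _ nP1) => //.
    have -> : B1^T - B2^T = (B1 - B2)^T by apply/matrixP => i j; rewrite !mxE.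
    exact: le_trans (specnorm_tr _) hB.
  - apply: le_trans (specnormM _ _) (ler_pM _ _ _ nF1) => //.
    apply: le_trans (specnormM _ _) (ler_pM _ _ _ nP) => //.
    exact: le_trans (specnorm_tr _) hB2.
  apply: le_trans (specnormM _ _) (ler_pM _ _ _ nF) => //.
  apply: le_trans (specnormM _ _) (ler_pM _ _ _ nP2) => //.
  exact: le_trans (specnorm_tr _) hB2.
rewrite -scalerBr; apply: le_trans (specnormZ_le _ _) _; rewrite ger0_norm //.
rewrite mulmx_difference.
have h1 := le_trans (specnormM (E1 - E2) X1) (ler_pM (specnorm_ge0 _) (specnorm_ge0 _) nE nX1).
have h2 := le_trans (specnormM E2 (X1 - X2)) (ler_pM (specnorm_ge0 _) (specnorm_ge0 _) nE2 nX).
apply: le_trans (ler_wpM2l (ler0n _ 2) (le_trans (specnormD _ _) (lerD h1 h2))) _.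
rewrite le_eqVlt; apply/orP; left; apply/eqP.
rewrite /het_gain /het_gain_input /e /p /s /al; field.
by rewrite !gt_eqF.
Qed.

(** The first stage costs at least tr(K^T Ru K S) >= mu tr(K^T Ru K), which
dominates mu l ||K||^2. *)
Lemma policy_bounded n nu (Q : 'M[R]_n) (Ru : 'M[R]_nu) (D : probability (borel_cV R n) R) (H : R)
    (A : 'M[R]_n) (B : 'M[R]_(n, nu)) K (mu l C : R) :
  {ae D, forall x0 : borel_cV R n, enorm (x0 : 'cV[R]_n) <= H} ->
  psd Q -> psd (Ru - l *: 1%:M) -> 0 < l -> 0 < mu -> psd (second_moment D - mu *: 1%:M) ->
  (cost Q Ru D A B K <= C%:E)%E -> specnorm K <= Num.sqrt (C / mu / l).
Proof.
move=> DH pQ pRl l0 mu0 pSmu hC.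
have pR : psd Ru.
  by rewrite -[Ru](subrK (l *: 1%:M)); apply: psdD => //; apply: psdZ (psd1 _ _); exact: ltW.
have pKRK := psd_congr K pR.
have hW : \tr (weight Q Ru K *m second_moment D) <= C.
  by rewrite -lee_fin; apply: le_trans hC; exact: (cost_ge_weight DH).
have tr_le : \tr (K^T *m Ru *m K) <= C / mu.
  rewrite ler_pdivlMr // mulrC; apply: le_trans (mxtrace_psd_lower pKRK pSmu) _.
  apply: le_trans hW; rewrite /weight mulmxDl linearD /= lerDr.
  exact: mxtrace_psd_ge0 (second_moment_psd DH).
have C0 : 0 <= C / mu.
  apply: le_trans tr_le; have := mxtrace_psd_ge0 pKRK (psd1 R n).
  by rewrite mulmx1.
apply: specnorm_le => [|x]; first exact: sqrtr_ge0.
rewrite -(@ler_pXn2r _ 2) ?nnegrE ?mulr_ge0 ?sqrtr_ge0 ?enorm_ge0 // exprMn.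
have -> : Num.sqrt (C / mu / l) ^+ 2 = C / mu / l.
  by rewrite sqr_sqrtr // divr_ge0 // ltW.
rewrite !enorm_sqr mulrAC ler_pdivlMr // mulrC.
have := pRl.2 (K *m x); rewrite !bilE subr_ge0 => /le_trans; apply.
rewrite -bil_mul; apply: le_trans (psd_bil_le_trace x pKRK) _.
by rewrite ler_wpM2r.
Qed.

Lemma specnorm_le_norm_max M m n (S : 'I_M -> 'M[R]_(m, n)) i : specnorm (S i) <= norm_max S.
Proof. exact: le_bigmax. Qed.

Lemma norm_max_ge0 M m n (S : 'I_M -> 'M[R]_(m, n)) : 0 <= norm_max S.
Proof. exact: bigmax_ge_id. Qed.

Section CostMax.
Variables (M n nu : nat) (Q : 'M[R]_n) (Ru : 'M[R]_nu) (D : probability (borel_cV R n) R).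
Variables (A : 'I_M -> 'M[R]_n) (B : 'I_M -> 'M[R]_(n, nu)) (K : 'M[R]_(nu, n)).
Hypotheses (pQ : psd Q) (pR : psd Ru).

Lemma cost_le_cost_max i : (cost Q Ru D (A i) (B i) K <= cost_max Q Ru D A B K)%E.
Proof. exact: le_bigmax. Qed.

Lemma cost_max_ge0 (i : 'I_M) : (0 <= cost_max Q Ru D A B K)%E.
Proof. exact: le_trans (cost_ge0 _ _ _ pQ pR _) (cost_le_cost_max i). Qed.

Lemma fine_cost_le_max i : (forall j, cost Q Ru D (A j) (B j) K < +oo)%E ->
  fine (cost Q Ru D (A i) (B i) K) <= fine (cost_max Q Ru D A B K).
Proof.
move=> h; apply: fine_le; last exact: cost_le_cost_max.
  by rewrite ge0_fin_numE ?h //; exact: cost_ge0.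
rewrite ge0_fin_numE; first exact: bigmax_lt.
exact: cost_max_ge0 i.
Qed.

Lemma fine_cost_max_le (i : 'I_M) C : (forall j, cost Q Ru D (A j) (B j) K <= C%:E)%E ->
  fine (cost_max Q Ru D A B K) <= C.
Proof.
move=> h; have hC : (cost_max Q Ru D A B K <= C%:E)%E.
  by apply: bigmax_le => //; exact: leNye.
rewrite -lee_fin fineK // ge0_fin_numE; last exact: cost_max_ge0 i.
exact: le_lt_trans hC (ltry _).
Qed.

End CostMax.

(** The sublevel inequality reads c <= beta c0 - (beta - 1) cstar once the optimal
cost is known to be finite, which cstar <= c0 ensures. *)
Lemma sublevel_cost_le (beta : R) (c cstar c0 : \bar R) :
  1 <= beta -> (0 <= cstar)%E -> (cstar <= c0)%E -> c0 \is a fin_num ->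
  (c - cstar <= beta%:E * (c0 - cstar))%E -> (c <= (beta * fine c0)%:E)%E.
Proof.
move=> b1; case: c0 => // r0 cs0 cs _.
case: cstar cs0 cs => // r; rewrite !lee_fin => r_ge0 r_le.
rewrite -EFinB -EFinM leeBlDr //= => /le_trans; apply.
by rewrite -EFinD lee_fin; nra.
Qed.

End Heterogeneity.

(** The summand 1 makes the value positive even when the gain vanishes. *)
Definition h1_het (R : realType) (p : lqr_params R) : R :=
  1 + het_gain (normA p) (normB p) (normRu p) (muSigma0 p) (sminQ p) (normK p) (Cmax p).

Definition h2_het (R : realType) (p : lqr_params R) : R :=
  1 + (normK p * het_gain (normA p) (normB p) (normRu p) (muSigma0 p) (sminQ p) (normK p) (Cmax p)
       + het_gain_input (normA p) (normB p) (muSigma0 p) (sminQ p) (normK p) (Cmax p)).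

Theorem lemma3 (R : realType) :
  exists h1 h2 : lqr_params R -> R,
  forall (M nx nu : nat)
    (A : 'I_M -> 'M[R]_nx) (B : 'I_M -> 'M[R]_(nx, nu))
    (Q : 'M[R]_nx) (Ru : 'M[R]_nu)
    (D : probability (borel_cV R nx) R) (H : R)
    (Kstar : 'I_M -> 'M[R]_(nu, nx))
    (eps1 eps2 : R) (K0 : 'M[R]_(nu, nx)) (beta : R),
  (0 < M)%N -> (0 < nx)%N -> (0 < nu)%N ->
  (forall i, stabilizable (A i) (B i)) ->
  mean D = 0 ->
  0 < sigma_min (second_moment D) ->
  {ae D, forall x0 : borel_cV R nx, enorm (x0 : 'cV[R]_nx) <= H} ->
  posdef Q -> posdef Ru ->
  (forall i K,
    (cost Q Ru D (A i) (B i) (Kstar i) <= cost Q Ru D (A i) (B i) K)%E) ->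
  0 < eps1 -> 0 < eps2 ->
  (forall i j, specnorm (A i - A j) <= eps1) ->
  (forall i j, specnorm (B i - B j) <= eps2) ->
  (forall i, stabilizes (A i) (B i) K0) ->
  1 <= beta ->
  let G0 := sublevel Q Ru D A B Kstar K0 beta in
  let par := params_at Q Ru D A B in
  [/\ (forall K, G0 K \/ (forall i, stabilizes (A i) (B i) K) ->
         0 < h1 (par K) /\ 0 < h2 (par K)),
      (exists b : R, forall K, G0 K -> h1 (par K) <= b /\ h2 (par K) <= b) &
      (forall (i j : 'I_M) (K : 'M[R]_(nu, nx)),
         (forall l, stabilizes (A l) (B l) K) ->
         specnorm (grad_cost Q Ru D (A i) (B i) K
                   - grad_cost Q Ru D (A j) (B j) K)
           <= eps1 * h1 (par K) + eps2 * h2 (par K))].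
Proof.
exists (@h1_het R), (@h2_het R).
move=> M nx nu A B Q Ru D H Kstar eps1 eps2 K0 beta M0 nx0 nu0 _ _ mu0 DH dQ dR
  opt e10 e20 hA hB sK0 beta1 G0 par.
have pQ := posdef_psd dQ; have pR := posdef_psd dR.
have sg0 := sigma_min_gt0 nx0 dQ.
have pQsg := sigma_min_psd nx0 pQ.
have pSmu := sigma_min_psd nx0 (second_moment_psd DH).
pose i0 : 'I_M := Ordinal M0.
have cost_fin i K : stabilizes (A i) (B i) K -> (cost Q Ru D (A i) (B i) K < +oo)%E.
  move=> /(spectral_radius_stable nx0) sF.
  have [P eP] := lyap_exists (weight Q Ru K) sF.
  by rewrite (cost_stable DH sF eP) ltry.
have Cmax0 K : 0 <= fine (cost_max Q Ru D A B K) by exact/fine_ge0/cost_max_ge0.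
have K_ge0 (K : 'M[R]_(nu, nx)) := specnorm_ge0 K.
have A0 := norm_max_ge0 A; have B0 := norm_max_ge0 B; have Ru0 := specnorm_ge0 Ru.
have gain0 K := het_gain_ge0 A0 B0 Ru0 mu0 sg0 (K_ge0 K) (Cmax0 K).
have gain_in0 K := het_gain_input_ge0 A0 B0 mu0 sg0 (K_ge0 K) (Cmax0 K).
split.
- move=> K _; split; apply: (ltr_pwDl ltr01); first exact: gain0.
  exact: addr_ge0 (mulr_ge0 (K_ge0 K) (gain0 K)) (gain_in0 K).
- have [l l0 pRl] := posdef_coercive dR.
  pose c0 i := fine (cost Q Ru D (A i) (B i) K0).
  have c00 i : 0 <= c0 i by exact/fine_ge0/cost_ge0.
  pose Cb := \sum_i beta * c0 i.
  have G0C K i : G0 K -> (cost Q Ru D (A i) (B i) K <= Cb%:E)%E.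
    move=> /(_ i I) /= GK.
    apply: (@le_trans _ _ (beta * c0 i)%:E).
      apply: sublevel_cost_le GK => //; first exact: cost_ge0.
      by rewrite ge0_fin_numE ?cost_fin //; exact: cost_ge0.
    rewrite lee_fin /Cb (bigD1 i) //= lerDl; apply: sumr_ge0 => j _.
    by rewrite mulr_ge0 // (le_trans ler01).
  pose kb := Num.sqrt (Cb / sigma_min (second_moment D) / l).
  exists (Num.max (1 + het_gain (norm_max A) (norm_max B) (specnorm Ru)
                        (sigma_min (second_moment D)) (sigma_min Q) kb Cb)
                  (1 + (kb * het_gain (norm_max A) (norm_max B) (specnorm Ru)
                        (sigma_min (second_moment D)) (sigma_min Q) kb Cb
                      + het_gain_input (norm_max A) (norm_max B)
                        (sigma_min (second_moment D)) (sigma_min Q) kb Cb))).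
  move=> K GK.
  have Kkb : specnorm K <= kb by exact: (policy_bounded DH pQ pRl l0 mu0 pSmu (G0C K i0 GK)).
  have CCb : fine (cost_max Q Ru D A B K) <= Cb.
    by apply: (fine_cost_max_le pQ pR i0) => j; exact: G0C.
  have g_le := het_gain_le A0 B0 Ru0 mu0 sg0 (K_ge0 K) (Cmax0 K) Kkb CCb.
  have gi_le := het_gain_input_le A0 B0 mu0 sg0 (K_ge0 K) (Cmax0 K) Kkb CCb.
  rewrite !le_max; split; apply/orP; [left|right]; rewrite lerD2l //.
  exact: lerD (ler_pM (K_ge0 K) (gain0 K) Kkb g_le) gi_le.
move=> i j K sK.
have sF l := spectral_radius_stable nx0 (sK l).
have cfin l := cost_fin l K (sK l).
apply: le_trans (grad_cost_difference_le DH pQ pR mu0 sg0 pSmu pQsg (sF i) (sF j)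
  (specnorm_le_norm_max A i) (specnorm_le_norm_max A j)
  (specnorm_le_norm_max B i) (specnorm_le_norm_max B j) (hA i j) (hB i j)
  (fine_cost_le_max pQ pR i cfin) (fine_cost_le_max pQ pR j cfin)) _.
by apply: lerD; (apply: ler_wpM2l; [exact: ltW|rewrite lerDr]).
Qed.
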